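(* For every integer $g\ge 0$, $$\mathbf{C}_g^{[3]}(z)=\frac{P_g^{[3]}(z)}{(1-4z)^{3g+\frac92}},$$ where $P_g^{[3]}(z)$ is a polynomial with integer coefficients satisfying $$\begin{aligned}P_g^{[3]}(z)={}&z^{-1}P_{g+1}^{[2]}(z)-2\sum_{h=1}^{g} P_h(z)P_{g+1-h}^{[2]}(z)-2z^2(1-4z)^2P_{g+1}''(z)\\&-((48g+20)z+5)\,z(1-4z)P_{g+1}'(z)\\&-\bigl(48(2g+1)(3g+2)z^2+(60g+44)z+1\bigr)P_{g+1}(z).\end{aligned}$$ In addition, the polynomial $P_g^{[3]}(z)$ has degree at most $3g+3$ and is divisible by $z^{2g+2}$.
   Context: Gluings. An $m$-gon ($m\ge1$) is a disk with $m$ marked points (vertices) on its boundary circle, which divide the counterclockwise oriented circle into $m$ arcs (edges); $1$-gons and $2$-gons are allowed. For $n\ge1$ and positive integers $m_1,\dots,m_k$ with $m_1+\dots+m_k=2n$, take $k$ distinguishable (numbered) polygons $D_1,\dots,D_k$, where $D_i$ is an $m_i$-gon with one distinguished edge (so all $2n$ edges are distinguishable). A gluing is a partition of the $2n$ edges into $n$ pairs, the two edges in each pair being identified with opposite orientations; the result is a compact orientable surface without boundary. $\varepsilon_g(m_1,\dots,m_k;k)$ is the number of gluings giving a connected surface of genus $g$, and $\varepsilon_g(n,k)=\sum_{m_1+\dots+m_k=2n}\varepsilon_g(m_1,\dots,m_k;k)$, the sum being over all $k$-tuples of positive integers. Equivalently, for $n\ge 1$, $\varepsilon_g(m_1,\dots,m_k;k)$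 is the number of fixed-point-free involutions $\iota\in S_{2n}$ such that, for the permutation $\tau\in S_{2n}$ with cycles formed by successive blocks of consecutive integers of lengths $m_1,\dots,m_k$ (each block cyclically permuted in increasing order), the group $\langle\iota,\tau\rangle$ is transitive and $\tau\iota$ has exactly $n-k+2-2g$ cycles. For $n=0$: $\varepsilon_0(0,1)=1$ and $\varepsilon_g(0,k)=0$ if $g+k>1$. Generating functions: $\mathbf{C}_g^{[k]}(z)=\sum_{n\ge0}\varepsilon_g(n,k)z^n$ (formal power series), and $\mathbf{C}_g(z)=\mathbf{C}_g^{[1]}(z)$. The polynomials $P_g$ (for $g\ge1$) and $P_g^{[2]}$ (for $g\ge0$) are defined by $\mathbf{C}_g(z)=P_g(z)/(1-4z)^{3g-\frac12}$ and $\mathbf{C}_g^{[2]}(z)=P_g^{[2]}(z)/(1-4z)^{3g+2}$. It is known (earlier work) that $P_g$ is a polynomial with integer coefficients of degree at most $3g-1$ divisible by $z^{2g}$, and that $P_g^{[2]}$ is a polynomial with integer coefficients of degree at most $3g+1$ divisible by $z^{2g+1}$. Fractional powers of $1-4z$ are power series with constant term $1$. *)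

(* Defs.v *)
(* MathComp world. *)
From mathcomp Require Import all_boot all_order all_fingroup all_algebra.

Set Implicit Arguments.
Unset Strict Implicit.
Unset Printing Implicit Defensive.

Import GRing.Theory.
Local Open Scope ring_scope.

(* [Tagged _ j : edge m] with tag [i] is the [j]-th edge of the polygon [D_i],
   an [m i]-gon, counted counterclockwise from its distinguished edge (j = 0).
   Enumerating the edges lexicographically identifies the permutations of
   [edge m] with S_2n, the polygons being successive blocks of integers. *)
Definition edge (k : nat) (m : 'I_k -> nat) : Type := {i : 'I_k & 'I_(m i)}.

Definition next_edge k (m : 'I_k -> nat) (x : edge m) : edge m :=
  Tagged (fun i => 'I_(m i)) (ordS (tagged x)).

Lemma next_edge_inj k (m : 'I_k -> nat) : injective (@next_edge k m).
Proof.
move=> [i a] [j b] /eqP; rewrite -tag_eqE /tag_eq /= => /andP[/eqP eij].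
case: _ / eij b => b; by rewrite tagged_asE => /eqP /ordS_inj ->.
Qed.

(* The permutation tau, whose cycles are the boundaries of the polygons. *)
Definition tau k (m : 'I_k -> nat) : {perm edge m} := perm (@next_edge_inj k m).

(* A pairing of the elements of [E], as a fixed-point-free involution. *)
Definition is_pairing (E : finType) (iota : {perm E}) : bool :=
  [forall x, (iota x != x) && (iota (iota x) == x)].

(* The surface glued from [k] polygons with 2n edges has [k] faces, [n] edges
   and the cycles of tau iota as vertices; the last clause is Euler's formula
   2 - 2g = #vertices - n + k, i.e. #vertices = n - k + 2 - 2g in Z.
   The product (iota * tau)%g applies iota first. *)
Definition is_gluing (g n k : nat) (m : 'I_k -> nat) (iota : {perm edge m}) :
    bool :=
  [&& is_pairing iota,
      [transitive <<[set iota; tau m]>>%g, on [set: edge m] | 'P]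
    & #|porbits (iota * tau m)%g| + k + 2 * g == n + 2]%N.

Definition eps_m (g n k : nat) (m : 'I_k -> nat) : nat :=
  #|[set iota : {perm edge m} | is_gluing g n iota]|.

(* Parts of a composition of 2n are at most 2n, which makes the sum finite. *)
Definition eps (g n k : nat) : nat :=
  if n is 0 then ((g == 0) && (k == 1))%N
  else (\sum_(m : {ffun 'I_k -> 'I_(2 * n).+1} |
          [forall i, 0 < m i] && (\sum_i m i == 2 * n)) eps_m g n (fun i => m i))%N.

(* Formal power series over Q, as sequences of coefficients. *)
Definition fps : Type := nat -> rat.

Definition fps_mul (a b : fps) : fps :=
  fun n => \sum_(i < n.+1) a i * b (n - i)%N.

Definition fps_poly (p : {poly int}) : fps := fun n => (p`_n)%:~R.

(* (1 - 4z)^a, as the binomial series with coefficients (-4)^n binom(a, n). *)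
Definition pow_1m4z (a : rat) : fps :=
  fun n => (- 4) ^+ n * (\prod_(j < n) (a - j%:R)) / (n`!)%:R.

(* p(z) / (1 - 4z)^a *)
Definition poly_div_pow (p : {poly int}) (a : rat) : fps :=
  fps_mul (fps_poly p) (pow_1m4z (- a)).

(* [C k g] is the series C_g^{[k]}(z). *)
Definition C (k g : nat) : fps := fun n => (eps g n k)%:R.

(* Main.v *)
From HB Require Import structures.
Require Import Defs.
From mathcomp Require Import all_boot all_order all_fingroup all_algebra.
From mathcomp Require Import boolp zify ring.
Import GRing.Theory.
Local Open Scope ring_scope.

Set Implicit Arguments.
Unset Strict Implicit.
Unset Printing Implicit Defensive.

Import Order.TTheory Num.Theory.

(** The idea is to cut one edge of the glued surface. Cutting the edge that
contains the distinguished edge of the first of two polygons either divides this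
polygon in two or merges it with the second one. On the level of generating
functions, writing D for the derivation d/dz, this gives

  C_(g+1)^[2] = z C_g^[3] + 2 z sum_(h=0..g+1) C_h C_(g+1-h)^[2]
                + z (2 z^2 D^2 + 5 z D + 1) C_(g+1),

where the sum accounts for the three polygons that result from a division and
fall into two components, and the differential operator accounts for the
(n+1)(2n+1) ways to obtain a polygon with 2n edges by a merger
(lemma [C_series_rec]). Solving for C_g^[3] and putting everything over the
denominator (1-4z)^(3g+9/2) yields the formula:
- the term h = 0 combines with the left-hand side, since the same argument for a
  single polygon gives C_0 = 1 + z C_0^2, that is 1 - 2 z C_0 = (1-4z)^(1/2)
  ([C_series_sqrt]);
- the term h = g+1 contains C_0^[2] = z (1-4z)^(-2); together with the
  differential operator it becomes an operator on the polynomial P_(g+1)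
  ([face_op_pow_series]).
The operator raises degrees by 2, which bounds the degree of P_g^[3] by 3g+4
only; but it multiplies the leading monomial of degree 3g+2 by zero
([coef_face_op]).

The recursion is obtained without following connectivity through the cut. The
sum [gpoly sh] of 'X^(number of vertices) over all pairings of the edges of
polygons of sizes [sh], connected or not, satisfies a simple recursion
([gluing_sum_poly]), in which a 0-gon is an isolated vertex and contributes a
factor 'X. The sums over the connected pairings are the cumulants of [gpoly]
([pairing_sum_2], [pairing_sum_3]), because pairings that preserve a given
decomposition of the polygons into groups are counted by products
([gluing_sum_blocks]); the recursion for the cumulants is then algebra
([kappa2S]). Extracting the genus from the number of vertices in a product needs
that the genus of a connected surface is a natural number; for one and two
polygons this follows by building up the pairing one transposition at a time
([ncyc_pairing]). *)

(** * Cycles of permutations and the removal of an edge *)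

Section Cycles.
Variable E : finType.
Implicit Types (s t p : {perm E}) (x y : E) (a b c : seq E) (cs : seq (seq E))
  (U : {set E}) (iota theta : {perm E}).

Definition ncyc s := #|porbits s|.

(** Multiplying by a transposition that involves a fixed point inserts this fixed
point into another cycle, so one cycle disappears. *)
Lemma ncyc_mulr_tperm s x y :
  s x = x -> x != y -> (ncyc (s * tperm x y)%g).+1 = ncyc s.
Proof.
move=> sx xy; rewrite /ncyc -(porbitsV (s * _)) invMg tpermV.
have := porbits_mul_tperm s^-1 x y; rewrite /= porbitV porbitsV xy.
suff -> : x \notin porbit s y by rewrite addn2 addn1 => -[].
rewrite porbit_sym; apply/porbitP => -[i]; apply/eqP.
suff -> : (s ^+ i)%g x = x by rewrite eq_sym.
by elim: i => [|i IH]; rewrite ?expg0 ?perm1 // expgSr permM IH.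
Qed.

(** The cyclic permutation along a list, as a product of transpositions; each new
head is inserted before the old one. This form makes the effect of cutting and of
removing edges a matter of rewriting products. *)
Fixpoint cyc a : {perm E} :=
  if a is x :: b then (cyc b * tperm x (head x b))%g else 1%g.

Definition cycs cs : {perm E} := (\prod_(c <- cs) cyc c)%g.

Lemma cyc_out a x : x \notin a -> cyc a x = x.
Proof.
elim: a => [|y a IH] /=; first by rewrite perm1.
rewrite inE negb_or => /andP[xy xa]; rewrite permM (IH xa) tpermD //.
  by rewrite eq_sym.
by case: a xa {IH} => [|z a] /=; rewrite eq_sym // inE negb_or => /andP[].
Qed.

Lemma cycJ a p : (cyc a ^ p = cyc (map p a))%g.
Proof.
elim: a => [|x a IH] /=; first by rewrite conj1g.
by rewrite conjMg IH tpermJ; case: a {IH}.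
Qed.

Lemma cyc_cat a x b : cyc (a ++ x :: b) = (cyc (x :: b) * cyc (rcons a x))%g.
Proof.
elim: a => [|y a IH]; first by rewrite /= tperm1 !mulg1.
by rewrite [LHS]/= IH /= -mulgA; case: a {IH}.
Qed.

(** The induction step moves one transposition past another one, which changes the
latter by conjugation. *)
Lemma cyc_rcons a x : uniq (x :: a) -> cyc (rcons a x) = cyc (x :: a).
Proof.
elim: a => [|y a IH] //= /andP[]; rewrite inE negb_or => /andP[xy xa] /andP[ya ua].
rewrite IH /=; last by rewrite xa.
case: a xa ya ua {IH} => [|z a] /=.
  by rewrite !tperm1 !mul1g ?mulg1 tpermC.
rewrite !inE !negb_or => /andP[xz xa] /andP[yz ya] _.
rewrite -!mulgA; congr (_ * (_ * _))%g.
by rewrite conjgC tpermJ tpermR tpermD // eq_sym.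
Qed.

Lemma cyc_rot_cat a b : uniq (a ++ b) -> cyc (a ++ b) = cyc (b ++ a).
Proof.
elim: a b => [|x a IH] b; first by rewrite cats0.
move=> u; rewrite cat_cons -cyc_rcons // -cats1 -catA IH /= -?catA ?cat1s //.
by rewrite catA cats1 rcons_uniq -cons_uniq -cat_cons.
Qed.

(** Multiplying by a transposition cuts a cycle in two; read from right to left,
after moving the transposition to the other side, it merges two cycles. *)
Lemma tperm_cyc x y a b : uniq (x :: a ++ y :: b) ->
  (tperm x y * cyc (x :: a ++ y :: b) = cyc (x :: b) * cyc (y :: a))%g.
Proof.
move=> u; have /and5P[/and3P[xa xy xb] ua /andP[ya _] yb ub]:
  [&& [&& x \notin a, x != y & x \notin b], uniq a,
      (y \notin a) && ~~ has (mem a) b, y \notin b & uniq b].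
  by move: u; rewrite /= mem_cat inE !negb_or cat_uniq /= negb_or.
have u1 : uniq (y :: a) by rewrite /= ya.
have u2 : uniq (x :: rcons a y).
  by rewrite /= mem_rcons inE negb_or xy xa rcons_uniq.
have key : (tperm x y * cyc (y :: b) * tperm x y = cyc (x :: b))%g.
  have -> : x :: b = map (tperm x y) (y :: b).
    rewrite map_cons tpermR; congr cons; rewrite map_id_in // => z zb.
    by rewrite tpermD //; [apply: contraNneq xb | apply: contraNneq yb] => ->.
  by rewrite -cycJ /conjg tpermV; apply: (esym (mulgA _ _ _)).
rewrite -cat_cons cyc_cat rcons_cons -(cyc_rcons u2) -cats1 cat_rcons cyc_cat.
rewrite (cyc_rcons u1) -key -!mulgA; do 3 congr (_ * _)%g.
by rewrite /= tperm1 !mul1g tpermC.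
Qed.

Lemma cyc_commute a p : {in a, forall x, p x = x} -> commute (cyc a) p.
Proof.
move=> pa; apply/commgP/conjg_fixP; rewrite cycJ.
by congr cyc; apply: map_id_in.
Qed.

(** Pairings of a subset are extended by fixed points, so that the set of edges
never has to be changed when edges are removed. *)
Definition pairing_on (U : {set E}) (iota : {perm E}) : bool :=
  [forall x, if x \in U then (iota x != x) && (iota (iota x) == x)
             else iota x == x].

Lemma pairing_onP U iota :
  reflect (forall x, if x \in U then iota x <> x /\ iota (iota x) = x
                     else iota x = x) (pairing_on U iota).
Proof.
apply: (iffP forallP) => h x; move: (h x); case: ifP => _.
- by move=> /andP[/eqP ? /eqP ?].
- by move/eqP.
- by move=> [/eqP -> ->] /=.
- by move=> ->.
Qed.

Definition gluing_sum (U : {set E}) (theta : {perm E}) : {poly int} :=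
  \sum_(iota | pairing_on U iota) 'X^(ncyc (iota * theta)).

Lemma pairing_on_in U iota x : pairing_on U iota -> (iota x \in U) = (x \in U).
Proof.
move=> /pairing_onP h; move: (h x); case: (boolP (x \in U)) => xU; last first.
  by move=> ->; rewrite (negbTE xU).
move=> [ne ix]; apply/negPn/negP => ixU; apply: ne.
by have := h (iota x); rewrite (negbTE ixU) ix.
Qed.

Lemma pairing_on_remove U x y iota : x \in U -> y \in U -> x != y ->
  pairing_on (U :\ x :\ y) iota = 
  pairing_on U (iota * tperm x y) && ((iota * tperm x y)%g x == y).
Proof.
move=> xU yU xy; apply/pairing_onP/andP => [h | [/pairing_onP h /eqP e] z].
  have ix : iota x = x by have := h x; rewrite !inE eqxx andbF.
  have iy : iota y = y by have := h y; rewrite !inE eqxx.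
  rewrite permM ix tpermL; split=> //; apply/pairing_onP => z; rewrite !permM.
  have [->|zx] := eqVneq z x.
    by rewrite xU ix tpermL iy tpermR; split => //; apply/eqP; rewrite eq_sym.
  have [->|zy] := eqVneq z y.
    by rewrite yU iy tpermR ix tpermL; split => //; apply/eqP.
  have := h z; rewrite !inE zx zy /=; case: ifP => zU.
    have izx : x != iota z by rewrite -{1}ix (inj_eq perm_inj) eq_sym.
    have izy : y != iota z by rewrite -{1}iy (inj_eq perm_inj) eq_sym.
    by move=> [ne iz]; rewrite tpermD // iz tpermD // eq_sym.
  by move=> ->; rewrite tpermD // eq_sym.
have ix : iota x = x.
  by apply: (@perm_inj _ (tperm x y)); rewrite tpermL -[RHS]e permM.
have iy : iota y = y.
  have := h x; rewrite xU => -[_]; rewrite e permM => h2.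
  by apply: (@perm_inj _ (tperm x y)); rewrite tpermR.
rewrite !inE; have [->|zy] := eqVneq z y => //=.
have [->|zx] := eqVneq z x => //=.
have izx : x != iota z by rewrite -{1}ix (inj_eq perm_inj) eq_sym.
have izy : y != iota z by rewrite -{1}iy (inj_eq perm_inj) eq_sym.
have := h z; rewrite !permM; case: ifP => zU; rewrite (tpermD izx izy) //.
move=> [ne iz]; split=> //; move: iz; rewrite tpermD //.
  by rewrite -{1}ix (inj_eq perm_inj).
by rewrite -{1}iy (inj_eq perm_inj).
Qed.

(** Splitting off the transposition of x and its partner y from the pairing, and
moving it to the face permutation, does not change the product of the two, hence
not the vertices. *)
Lemma gluing_sum_step U x theta : x \in U ->
  gluing_sum U theta =
  \sum_(y in U | y != x) gluing_sum (U :\ x :\ y) (tperm x y * theta).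
Proof.
move=> xU; rewrite /gluing_sum.
rewrite (partition_big (fun iota : {perm E} => iota x)
           (fun y => (y \in U) && (y != x))) /=; last first.
  move=> iota h; rewrite (pairing_on_in _ h) xU.
  by move/pairing_onP/(_ x): h; rewrite xU => -[/eqP].
apply: eq_bigr => y /andP[yU yx].
rewrite (reindex_inj (mulIg (tperm x y))) /=.
by apply: eq_big => [iota|iota _]; rewrite ?mulgA // pairing_on_remove // eq_sym.
Qed.

Lemma gluing_sum_remove U x y theta : x \notin U -> theta x = x -> x != y ->
  'X * gluing_sum U (theta * tperm x y) = gluing_sum U theta.
Proof.
move=> xU tx xy; rewrite /gluing_sum mulr_sumr; apply: eq_bigr => iota h.
rewrite -exprS mulgA ncyc_mulr_tperm // permM.
by move/pairing_onP/(_ x): h; rewrite (negbTE xU) => ->.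
Qed.

(** Deleting an unpaired edge x from its face a loses no vertex unless x is alone
in its face. If the face survives, then there is one cycle more, as x becomes a
fixed point; otherwise the permutation is unchanged, and the factor 'X on the right
stands for the empty face that arises. *)
Lemma gluing_sum_cons U x a theta : x \notin U -> x \notin a -> 
  {in x :: a, forall y, theta y = y} ->
  'X * gluing_sum U (cyc (x :: a) * theta) =
  'X^(a == [::]) * gluing_sum U (cyc a * theta).
Proof.
move=> xU xa ht /=; rewrite -mulgA.
have -> : commute (tperm x (head x a)) theta.
  apply/commgP/conjg_fixP; rewrite tpermJ !ht ?mem_head //.
  by case: (a) => [|y b] /=; rewrite !inE eqxx ?orbT.
case: a xa ht => [|y a] xa ht /=; first by rewrite tperm1 mulg1.
rewrite mulgA gluing_sum_remove ?mul1r //; last first.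
  by move: xa; rewrite inE negb_or => /andP[].
rewrite permM -[(cyc a * _)%g]/(cyc (y :: a)) cyc_out //.
by apply: ht; rewrite mem_head.
Qed.
End Cycles.

(** * The sum over all pairings, connected or not *)

(** The recursion obtained by cutting the first edge of the first polygon, of size
n + 1: it is glued to the (i+1)-st of the n other edges of the same polygon, or to
one of the edges of the j-th remaining polygon. The first argument bounds the
number of steps. *)
Fixpoint gpoly_rec (fuel : nat) (sh : seq nat) : {poly int} :=
  match fuel, sh with
  | f.+1, 0%N :: sh' => 'X * gpoly_rec f sh'
  | f.+1, n.+1 :: sh' =>
      \sum_(i < n) gpoly_rec f [:: i : nat, (n - i.+1)%N & sh']
      + \sum_(j < size sh') (nth 0%N sh' j)%:R *
          gpoly_rec f ((n + nth 0%N sh' j).-1 :: take j sh' ++ drop j.+1 sh')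
  | _, _ => 1
  end.

(** In every step the number of edges plus the number of polygons decreases. *)
Definition gpoly sh := gpoly_rec (sumn sh + size sh) sh.

Lemma sumn_drop_nth (sh : seq nat) (j : nat) : (j < size sh)%N ->
  sumn sh = (nth 0%N sh j + sumn (take j sh ++ drop j.+1 sh))%N.
Proof.
by move=> h; rewrite -{1}(cat_take_drop j sh) (drop_nth 0%N h) !sumn_cat /=; lia.
Qed.

Lemma size_drop_nth (T : Type) (s : seq T) (j : nat) : (j < size s)%N ->
  size s = (size (take j s ++ drop j.+1 s)).+1.
Proof. by move=> h; rewrite size_cat size_take size_drop h; lia. Qed.

Lemma gpoly_fuel f f' sh : (sumn sh + size sh <= f)%N ->
  (sumn sh + size sh <= f')%N -> gpoly_rec f sh = gpoly_rec f' sh.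
Proof.
elim: f f' sh => [|f IH] [|f'] [|[|n] sh] //= h h'; try lia.
  by rewrite (IH f') //; lia.
congr (_ + _); apply: eq_bigr => i _; have hi := ltn_ord i.
  by apply: IH => /=; lia.
congr (_ * _); have := sumn_drop_nth hi.
have := size_drop_nth hi; move=> hs hn.
by apply: IH => /=; lia.
Qed.

Lemma gpoly_nil : gpoly [::] = 1. Proof. by []. Qed.

Lemma gpoly0 sh : gpoly (0%N :: sh) = 'X * gpoly sh.
Proof. by rewrite /gpoly /= addnS /=; congr (_ * _); apply: gpoly_fuel; lia. Qed.

Lemma gpolyS n sh : gpoly (n.+1 :: sh) =
  \sum_(i < n) gpoly [:: i : nat, (n - i.+1)%N & sh]
  + \sum_(j < size sh) (nth 0%N sh j)%:R *
      gpoly ((n + nth 0%N sh j).-1 :: take j sh ++ drop j.+1 sh).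
Proof.
rewrite /gpoly /=.
congr (_ + _); apply: eq_bigr => i _; have hi := ltn_ord i.
  by apply: gpoly_fuel => /=; lia.
congr (_ * _); have := sumn_drop_nth hi.
have := size_drop_nth hi; move=> hs hn.
by apply: gpoly_fuel => /=; lia.
Qed.

Section Count.
Variable E : finType.
Implicit Types (s t p : {perm E}) (x y : E) (a b c : seq E) (cs : seq (seq E))
  (U : {set E}) (iota theta : {perm E}).

Lemma cycs_cons a cs : cycs (a :: cs) = (cyc a * cycs cs)%g.
Proof. by rewrite /cycs big_cons. Qed.

Lemma cycs_out cs x : x \notin flatten cs -> cycs cs x = x.
Proof.
elim: cs => [|a cs IH]; first by rewrite /cycs big_nil perm1.
rewrite /= mem_cat negb_or cycs_cons permM => /andP[xa xcs].
by rewrite cyc_out // IH.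
Qed.

(** Disjoint cycles commute. *)
Lemma cycs_move l c r : uniq (flatten (l ++ c :: r)) ->
  cycs (l ++ c :: r) = cycs (c :: l ++ r).
Proof.
elim: l => [|a l IH] //= u; rewrite cycs_cons IH; last first.
  by move: u; rewrite cat_uniq => /and3P[].
rewrite !cycs_cons !mulgA; congr (_ * _)%g; apply: cyc_commute => z za.
apply: cyc_out; move: u; rewrite cat_uniq => /and3P[_ /hasPn h _].
apply/negP => zc; have /h/negP[] // : z \in flatten (l ++ c :: r).
by apply/flattenP; exists c => //; rewrite mem_cat mem_head orbT.
Qed.

Lemma setD2_set_seq U x y (r : seq E) : perm_eq (enum U) [:: x, y & r] ->
  U :\ x :\ y = [set z in r].
Proof.
move=> h; have u : uniq [:: x, y & r] by rewrite -(perm_uniq h) enum_uniq.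
apply/setP => z; move: u; rewrite !inE -(mem_enum U) (perm_mem h) !inE /=.
rewrite inE negb_or => /and3P[/andP[xy xr] yr _].
have [->|zy] := eqVneq z y; first by rewrite (negbTE yr).
by have [->|zx] := eqVneq z x; rewrite ?(negbTE xr).
Qed.

Lemma perm_split x a y b cs :
  perm_eq (flatten ((x :: a ++ y :: b) :: cs))
          [:: x, y & flatten [:: a, b & cs]].
Proof. by apply/seq.permP => q; rewrite /= !count_cat /= ?count_cat; lia. Qed.

Lemma perm_merge x (s : seq E) (l : seq (seq E)) a y b (r : seq (seq E)) :
  perm_eq (flatten ((x :: s) :: l ++ (a ++ y :: b) :: r))
          [:: x, y & flatten ((s ++ b ++ a) :: l ++ r)].
Proof.
apply/seq.permP => q; rewrite /= !flatten_cat /=.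
by rewrite ?count_cat /= ?count_cat /= ?count_cat; lia.
Qed.

(** The first term of the recursion. The exponents of 'X make the two sides
comparable: every removed edge becomes a fixed point of the permutations, that is
a spurious cycle, and every empty list stands for a 0-gon, that is a vertex which
no cycle represents. *)
Lemma gluing_sum_split x a y b cs p :
  let cs0 := (x :: a ++ y :: b) :: cs in
  uniq (flatten cs0) -> {in flatten cs0, forall z, p z = z} ->
  'X^(size (flatten cs0) + count (@nilp E) cs0) *
    gluing_sum ([set z in flatten cs0] :\ x :\ y) (tperm x y * (cycs cs0 * p)) =
  'X^(size (flatten [:: a, b & cs]) + count (@nilp E) [:: a, b & cs]) *
    gluing_sum [set z in flatten [:: a, b & cs]] (cycs [:: a, b & cs] * p).
Proof.
move=> cs0 u hp.
have hperm := perm_split x a y b cs; rewrite -/cs0 in hperm.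
have hsz := perm_size hperm.
rewrite (@setD2_set_seq _ _ _ (flatten [:: a, b & cs])); last first.
  apply: perm_trans hperm; apply: uniq_perm => //; first exact: enum_uniq.
  by move=> z; rewrite mem_enum inE.
have u2 := u; rewrite (perm_uniq hperm) in u2.
have hp2 z : z \in [:: x, y & flatten [:: a, b & cs]] -> p z = z.
  by rewrite -(perm_mem hperm); apply: hp.
have ux : uniq (x :: a ++ y :: b).
  move: u; rewrite -[flatten cs0]/((x :: a ++ y :: b) ++ flatten cs) cat_uniq.
  by case/and3P.
set U := [set z in _].
have hxU : x \notin U by move: u2; rewrite inE /= inE negb_or => /and3P[/andP[]].
have hyU : y \notin U by move: u2; rewrite inE /= inE negb_or => /and3P[/andP[]].
rewrite /= inE negb_or !mem_cat !negb_or !cat_uniq has_cat negb_or in u2.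
case/and5P: u2 => [/and4P[xy xa xb xcs] /and3P[ya yb ycs] uqa /andP[hab hacs]].
case/and3P=> uqb hbcs uqcs.
have hfix z : z \in x :: b -> (cyc (y :: a) * (cycs cs * p))%g z = z.
  move=> zb; rewrite 2!permM cyc_out ?cycs_out ?hp2 //.
  - by move: zb; rewrite !inE /= !mem_cat => /orP[->|->] //; rewrite !orbT.
  - move: zb; rewrite inE => /predU1P[-> //|zb].
    by apply: contra hbcs => zc; apply/hasP; exists z.
  - move: zb; rewrite !inE => /predU1P[-> //|zb].
      by rewrite negb_or xy.
    rewrite negb_or; apply/andP; split; first by apply: contraNneq yb => <-.
    by apply: contra hab => zc; apply/hasP; exists z.
have hfix2 z : z \in y :: a -> (cyc b * (cycs cs * p))%g z = z.
  move=> zb; rewrite 2!permM cyc_out ?cycs_out ?hp2 //.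
  - by move: zb; rewrite !inE /= !mem_cat => /orP[->|->] //; rewrite !orbT.
  - move: zb; rewrite inE => /predU1P[-> //|zb].
    by apply: contra hacs => zc; apply/hasP; exists z.
  - move: zb; rewrite !inE => /predU1P[-> //|zb].
    by apply: contra hab => zc; apply/hasP; exists z.
have -> : (tperm x y * (cycs cs0 * p) =
           cyc (x :: b) * (cyc (y :: a) * (cycs cs * p)))%g.
  rewrite cycs_cons -(mulgA (cyc _)) (mulgA (tperm x y)) (tperm_cyc ux).
  by rewrite -(mulgA (cyc _)).
rewrite hsz !addSn 2!exprS.
have comm_ab : (cyc b * (cyc (y :: a) * (cycs cs * p)) =
                cyc (y :: a) * (cyc b * (cycs cs * p)))%g.
  rewrite (mulgA (cyc b)) (mulgA _ (cyc b)); congr (_ * _)%g.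
  apply: cyc_commute => z zb.
  apply: cyc_out; rewrite inE negb_or; apply/andP; split.
    by apply: contraNneq yb => <-.
  by apply: contra hab => zc; apply/hasP; exists z.
have -> : count (@nilp E) cs0 = count (@nilp E) cs by [].
rewrite [LHS](_ : _ = 'X * 'X^(size (flatten [:: a, b & cs]) + count (@nilp E) cs) *
  ('X * gluing_sum U (cyc (x :: b) * (cyc (y :: a) * (cycs cs * p))))); last by ring.
rewrite gluing_sum_cons // comm_ab.
rewrite [LHS](_ : _ = 'X^(b == [::])
  * 'X^(size (flatten [:: a, b & cs]) + count (@nilp E) cs) *
  ('X * gluing_sum U (cyc (y :: a) * (cyc b * (cycs cs * p))))); last by ring.
rewrite gluing_sum_cons // !cycs_cons !mulgA /=.
have -> c : nilp c = (c == [::]) by case: c.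
have -> c : nilp c = (c == [::]) by case: c.
by rewrite !exprD; ring.
Qed.

(** The second term of the recursion; the second face is rotated so that y is its
first edge. *)
Lemma gluing_sum_merge x (s : seq E) (l : seq (seq E)) a y b (r : seq (seq E)) p :
  let cs0 := (x :: s) :: l ++ (a ++ y :: b) :: r in
  let cs1 := (s ++ b ++ a) :: l ++ r in
  uniq (flatten cs0) -> {in flatten cs0, forall z, p z = z} ->
  'X^(size (flatten cs0) + count (@nilp E) cs0) *
    gluing_sum ([set z in flatten cs0] :\ x :\ y) (tperm x y * (cycs cs0 * p)) =
  'X^(size (flatten cs1) + count (@nilp E) cs1) *
    gluing_sum [set z in flatten cs1] (cycs cs1 * p).
Proof.
move=> cs0 cs1 u hp.
have hperm := perm_merge x s l a y b r; rewrite -/cs0 -/cs1 in hperm.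
have hsz := perm_size hperm.
rewrite (@setD2_set_seq _ _ _ (flatten cs1)); last first.
  apply: perm_trans hperm; apply: uniq_perm => //; first exact: enum_uniq.
  by move=> z; rewrite mem_enum inE.
have u2 := u; rewrite (perm_uniq hperm) in u2.
have hp2 z : z \in [:: x, y & flatten cs1] -> p z = z.
  by rewrite -(perm_mem hperm); apply: hp.
set U := [set z in _].
have hxU : x \notin U by move: u2; rewrite inE /= inE negb_or => /and3P[/andP[]].
have hyU : y \notin U by move: u2; rewrite inE /= inE negb_or => /and3P[/andP[]].
have uxy : uniq [:: x, y & s ++ b ++ a].
  move: u2; rewrite -[_ :: _ :: _]/([:: x, y & s ++ b ++ a] ++ flatten (l ++ r)).
  by rewrite cat_uniq; case/and3P.
have ux : uniq (x :: (b ++ a) ++ y :: s).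
  rewrite (perm_uniq (_ : perm_eq _ [:: x, y & s ++ b ++ a])) //.
  by apply/seq.permP => q; rewrite /= !count_cat /=; lia.
have out z : z \in [:: x, y & s ++ b ++ a] -> (cycs (l ++ r) * p)%g z = z.
  move=> hz; rewrite permM cycs_out ?hp2 //.
    by move: hz; rewrite !inE /= (mem_cat _ (s ++ _)) => /or3P[->|->|->]; rewrite ?orbT.
  move: u2; rewrite -[_ :: _ :: _]/([:: x, y & s ++ b ++ a] ++ flatten (l ++ r)).
  rewrite cat_uniq => /and3P[_ /hasPn h _].
  by apply: contraL hz => /h.
have memE : [:: x, y & s ++ b ++ a] =i x :: (b ++ a) ++ y :: s.
  by move=> z; rewrite !inE !mem_cat !inE; do ![case: (_ == _) | case: (_ \in _)].
have -> : (tperm x y * (cycs cs0 * p) =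
           cyc (x :: (b ++ a) ++ y :: s) * (cycs (l ++ r) * p))%g.
  rewrite cycs_cons cycs_move; last first.
    move: u; rewrite -[flatten _]/((x :: s) ++ flatten (l ++ (a ++ y :: b) :: r)).
    by rewrite cat_uniq => /and3P[].
  rewrite cycs_cons (@cyc_rot_cat _ a (y :: b)); last first.
    move: u; rewrite -[flatten _]/((x :: s) ++ flatten (l ++ (a ++ y :: b) :: r)).
    by rewrite flatten_cat /= !cat_uniq => /and3P[_ _ /and3P[_ _ /and3P[]]].
  rewrite (mulgA (cyc _)) -(mulgA _ (cycs _)) cat_cons -(tperm_cyc ux).
  by rewrite !(mulgA (tperm x y)) tperm2 mul1g.
have x_notin : x \notin (b ++ a) ++ y :: s by case/andP: ux.
have hc : count (@nilp E) cs0 = count (@nilp E) (l ++ r).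
  by rewrite /cs0 /= !count_cat /=; case: (a).
rewrite hc hsz !addSn 2!exprS.
rewrite [LHS](_ : _ = 'X * 'X^(size (flatten cs1) + count (@nilp E) (l ++ r)) *
  ('X * gluing_sum U (cyc (x :: (b ++ a) ++ y :: s) * (cycs (l ++ r) * p))));
  last by ring.
rewrite gluing_sum_cons //; last by move=> z; rewrite -memE; apply: out.
have -> : ((b ++ a) ++ y :: s == [::]) = false by case: (b ++ a).
rewrite mul1r cyc_rot_cat; last by case/andP: ux.
rewrite [LHS](_ : _ = 'X^(size (flatten cs1) + count (@nilp E) (l ++ r)) *
  ('X * gluing_sum U (cyc (y :: s ++ (b ++ a)) * (cycs (l ++ r) * p))));
  last by rewrite -cat_cons; ring.
have /and3P[_ yn _] := uxy.
rewrite gluing_sum_cons //; last by move=> z hz; apply: out; rewrite inE hz orbT.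
rewrite cycs_cons mulgA.
have -> : count (@nilp E) cs1 = ((s ++ b ++ a == [::]) + count (@nilp E) (l ++ r))%N.
  by rewrite /cs1 /=; case: (s ++ b ++ a).
by rewrite mulrA -exprD addnAC -addnA.
Qed.

(** A permutation p of the complement is carried along, because then the statement
also counts the pairings that do not mix two groups of faces: the second group,
once it is glued, takes the role of p. *)
Lemma gluing_sum_poly cs p :
  uniq (flatten cs) -> {in flatten cs, forall z, p z = z} ->
  'X^(size (flatten cs) + count (@nilp E) cs) *
    gluing_sum [set z in flatten cs] (cycs cs * p) =
  'X^(ncyc p) * gpoly (map size cs).
Proof.
have [N] := ubnP (size (flatten cs) + size cs).
elim: N => // N IH in cs *; case: cs => [|[|x s] cs] /= hN u hp.
- rewrite gpoly_nil mul1r mulr1 /gluing_sum (big_pred1 1%g) => [|iota /=].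
    by rewrite /cycs big_nil !mul1g.
  apply/pairing_onP/eqP => [h|-> z]; last by rewrite inE perm1.
  by apply/permP => z; move: (h z); rewrite inE perm1.
- rewrite add1n addnS gpoly0 exprS -mulrA.
  have -> : cycs ([::] :: cs) = cycs cs by rewrite cycs_cons mul1g.
  rewrite [in RHS]mulrCA; congr (_ * _); apply: IH => //.
  by move: hN; rewrite addnS.
set U := [set z in _]; set cs0 := (x :: s) :: cs.
have xU : x \in U by rewrite inE mem_head.
have us : uniq (s ++ flatten cs) by case/andP: u.
rewrite (gluing_sum_step _ xU).
rewrite (eq_bigl (fun y => y \in s ++ flatten cs)); last first.
  move=> y; rewrite !inE; have [->|//] := eqVneq y x.
  by case/andP: u => /negbTE ->.
  by rewrite andbT.
rewrite -big_uniq //= big_cat big_flatten gpolyS !mulrDr !mulr_sumr.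
congr (_ + _).
  rewrite (big_nth x) big_mkord; apply: eq_bigr => i _.
  set a := take i s; set y := nth x s i; set b := drop i.+1 s.
  have es : s = a ++ y :: b by rewrite /y -drop_nth // cat_take_drop.
  have hi := ltn_ord i.
  have u0 : uniq (flatten ((x :: a ++ y :: b) :: cs)) by rewrite -es.
  have hp0 : {in flatten ((x :: a ++ y :: b) :: cs), forall z, p z = z}.
    by rewrite -es.
  have hperm := perm_split x a y b cs.
  have := gluing_sum_split u0 hp0; rewrite -es => ->.
  rewrite IH.
  - congr (_ * gpoly _) => /=; congr [:: _, _ & _]; rewrite ?size_drop //.
    by rewrite size_takel // ltnW.
  - move: hN; rewrite /= !size_cat size_drop size_takel; last exact: ltnW.
    by move: hi; clear; lia.
  - by move: u0; rewrite (perm_uniq hperm) => /and3P[].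
  - by move=> z hz; apply: hp0; rewrite (perm_mem hperm) !inE hz !orbT.
rewrite (big_nth [::]) big_mkord size_map; apply: eq_bigr => j _.
have hj := ltn_ord j; set c := nth [::] cs j.
rewrite (nth_map [::]) // -/c -map_take -map_drop -map_cat.
set l := take j cs; set r := drop j.+1 cs.
have ecs : cs = l ++ c :: r by rewrite /c -drop_nth // cat_take_drop.
rewrite (big_nth x) big_mkord mulr_sumr.
rewrite (eq_bigr (fun=> 'X^(ncyc p) *
  gpoly ((size s + size c).-1 :: [seq size i | i <- l ++ r]))).
  by rewrite sumr_const card_ord [RHS]mulrCA mulr_natl.
move=> i _; have hi := ltn_ord i.
set a := take i c; set y := nth x c i; set b := drop i.+1 c.
have ec : c = a ++ y :: b by rewrite /y -drop_nth // cat_take_drop.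
have sz : size c = (size a + size b).+1 by rewrite ec size_cat /= addnS.
have u0 : uniq (flatten ((x :: s) :: l ++ (a ++ y :: b) :: r)).
  by rewrite -ec -ecs.
have hp0 : {in flatten ((x :: s) :: l ++ (a ++ y :: b) :: r), forall z, p z = z}.
  by rewrite -ec -ecs.
have hperm := perm_merge x s l a y b r.
have := gluing_sum_merge u0 hp0; rewrite -ec -ecs => ->.
rewrite IH.
- congr (_ * gpoly _) => /=; congr (_ :: _); rewrite !size_cat sz.
  by clear; lia.
- have := perm_size hperm; rewrite -ec -ecs; move: hN.
  by rewrite ecs /= !size_cat /=; clear; lia.
- by move: u0; rewrite (perm_uniq hperm) => /and3P[].
- by move=> z hz; apply: hp0; rewrite (perm_mem hperm) !inE hz !orbT.
Qed.
End Count.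

(** * Pairings that preserve groups of polygons *)

Section Blocks.
Variable E : finType.
Implicit Types (s t p : {perm E}) (x y : E) (a b c : seq E) (cs : seq (seq E))
  (U V : {set E}) (iota theta : {perm E}).

Lemma cycs_cat cs cs' : cycs (cs ++ cs') = (cycs cs * cycs cs')%g.
Proof. by rewrite /cycs big_cat. Qed.

Lemma perm_cycs cs cs' : uniq (flatten cs) -> perm_eq cs cs' ->
  cycs cs = cycs cs'.
Proof.
elim: cs cs' => [|c cs IH] cs' u; first by rewrite perm_sym => /perm_nilP ->.
move=> h; have hf := perm_flatten h.
have cin : c \in cs' by rewrite -(perm_mem h) mem_head.
case/splitPr: cin h hf => l r h hf.
have h2 : perm_eq cs (l ++ r).
  by move: h; rewrite perm_sym -cat1s perm_catCA perm_cons perm_sym.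
rewrite cycs_move -?(perm_uniq hf) // !cycs_cons (IH _ _ h2) //.
by move: u; rewrite /= cat_uniq => /and3P[].
Qed.

Lemma cycs_commute cs p :
  {in flatten cs, forall x, p x = x} -> commute (cycs cs) p.
Proof.
elim: cs => [|c cs IH] h; first by rewrite /cycs big_nil; exact: commute_sym (commute1 _).
rewrite cycs_cons; apply: commute_sym; apply: commuteM; apply: commute_sym.
  by apply: cyc_commute => z zc; apply: h; rewrite mem_cat zc.
by apply: IH => z zc; apply: h; rewrite mem_cat zc orbT.
Qed.

Lemma size_flatten_set cs : uniq (flatten cs) ->
  #|[set z in flatten cs]| = size (flatten cs).
Proof. by move=> u; rewrite cardsE; apply/card_uniqP. Qed.

Definition stable U iota : bool := [forall x, (x \in U) ==> (iota x \in U)].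

Lemma stableP U iota : reflect (forall x, x \in U -> iota x \in U) (stable U iota).
Proof. by apply: (iffP forallP) => h x; apply/implyP/h. Qed.

Lemma stable_norm U iota : stable U iota -> iota \in ('N(U | 'P))%g.
Proof.
move=> /stableP h; rewrite inE in_setT /= inE.
by apply/subsetP => x xU; rewrite inE /=; apply: h.
Qed.

Lemma restr_perm_out U iota x : x \notin U -> restr_perm U iota x = x.
Proof. exact: out_perm (restr_perm_on _ _). Qed.

Lemma pairing_on_out U iota x : pairing_on U iota -> x \notin U -> iota x = x.
Proof. by move=> /pairing_onP/(_ x) + /negbTE xU; rewrite xU. Qed.

Lemma pairing_on_prod U V i1 i2 : [disjoint U & V] ->
  pairing_on U i1 -> pairing_on V i2 ->
  [/\ {in U, (i1 * i2)%g =1 i1}, {in V, (i1 * i2)%g =1 i2},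
      stable U (i1 * i2) & pairing_on (U :|: V) (i1 * i2)].
Proof.
move=> dUV h1 h2.
have e1 : {in U, (i1 * i2)%g =1 i1}.
  move=> x xU; rewrite permM (pairing_on_out h2) //.
  by rewrite (disjointFr dUV) // (pairing_on_in _ h1).
have e2 : {in V, (i1 * i2)%g =1 i2}.
  by move=> x xV; rewrite permM (pairing_on_out h1) // (disjointFl dUV).
split=> //; first by apply/stableP => x xU; rewrite e1 // (pairing_on_in _ h1).
apply/pairing_onP => x; rewrite in_setU.
have [xU|xU] := boolP (x \in U).
  rewrite /= !e1 ?(pairing_on_in _ h1) //.
  by move/pairing_onP: h1 => /(_ x); rewrite xU.
have [xV|xV] /= := boolP (x \in V).
  rewrite !e2 ?(pairing_on_in _ h2) //.
  by move/pairing_onP: h2 => /(_ x); rewrite xV.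
by rewrite permM (pairing_on_out h1) // (pairing_on_out h2).
Qed.

Lemma pairing_on_restr U V iota : [disjoint U & V] ->
  pairing_on (U :|: V) iota -> stable U iota ->
  [/\ pairing_on U (restr_perm U iota), pairing_on V (restr_perm V iota)
   & (restr_perm U iota * restr_perm V iota)%g = iota].
Proof.
move=> dUV h hU.
have hV : stable V iota.
  apply/stableP => x xV; have := pairing_on_in x h.
  rewrite !inE xV orbT => /orP[|//] ixU.
  have := stableP _ _ hU _ ixU; move/pairing_onP: h => /(_ x).
  by rewrite inE xV orbT => -[_ ->] xU; rewrite (disjointFr dUV xU) in xV.
have rE Z x : stable Z iota -> x \in Z -> restr_perm Z iota x = iota x.
  by move=> hW xW; rewrite restr_permE ?stable_norm.
have hP (Z : {set E}) : Z \subset U :|: V -> stable Z iota ->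
    pairing_on Z (restr_perm Z iota).
  move=> sW hW; apply/pairing_onP => x; case: ifP => [xW|/negbT xW].
    have ixW := stableP _ _ hW _ xW; rewrite !rE //.
    by move/pairing_onP: h => /(_ x); rewrite (subsetP sW).
  by rewrite restr_perm_out.
split; try by apply: hP; rewrite ?subsetUl ?subsetUr.
apply/permP => x; rewrite permM; have [xU|xU] := boolP (x \in U).
  rewrite (rE U) // restr_perm_out // (disjointFr dUV) //; exact: (stableP _ _ hU).
rewrite (restr_perm_out _ xU); have [xV|xV] := boolP (x \in V).
  by rewrite rE.
by rewrite restr_perm_out // (pairing_on_out h) // inE negb_or xU.
Qed.

(** A pairing of a disjoint union that preserves one part is a product of pairings
of the parts. *)
Lemma pairing_sum_prod U V (P : pred {perm E}) (F : {perm E} -> {poly int}) :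
  [disjoint U & V] ->
  \sum_(iota | [&& pairing_on (U :|: V) iota, stable U iota & P iota]) F iota =
  \sum_(i2 | pairing_on V i2) \sum_(i1 | pairing_on U i1 && P (i1 * i2)%g)
      F (i1 * i2)%g.
Proof.
move=> dUV; rewrite pair_big_dep /=.
rewrite (reindex_onto (fun q : {perm E} * {perm E} => q.2 * q.1)%g
  (fun iota => (restr_perm V iota, restr_perm U iota))) /=; last first.
  by move=> iota /and3P[h hU _]; have [] := pairing_on_restr dUV h hU.
apply: eq_bigl => -[i2 i1] /=; apply/andP/and3P; last first.
  move=> [h2 h1 hP]; have [e1 e2 hs hp] := pairing_on_prod dUV h1 h2.
  rewrite hs hp hP; split=> //; apply/eqP.
  have [_ _ _] := pairing_on_restr dUV hp hs.
  have hV : stable V (i1 * i2)%g.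
    by apply/stableP => x xV; rewrite e2 // (pairing_on_in _ h2).
  congr (_, _); apply/permP => x.
    have [xV|xV] := boolP (x \in V).
      by rewrite restr_permE ?stable_norm // e2.
    by rewrite restr_perm_out // (pairing_on_out h2).
  have [xU|xU] := boolP (x \in U).
    by rewrite restr_permE ?stable_norm // e1.
  by rewrite restr_perm_out // (pairing_on_out h1).
move=> [/and3P[h hU hP] /eqP[e2 e1]].
have [h1 h2 _] := pairing_on_restr dUV h hU.
by rewrite e1 in h1; rewrite e2 in h2.
Qed.

(** Induction on the list of groups: for a fixed pairing i2 of the other groups,
the sum over the pairings of the first group is [gluing_sum_poly] with i2 and its
faces as the permutation of the complement. *)
Lemma gluing_sum_blocks (css : seq (seq (seq E))) p :
  uniq (flatten (flatten css)) ->
  {in flatten (flatten css), forall z, p z = z} ->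
  'X^(size (flatten (flatten css)) + count (@nilp E) (flatten css)) *
    \sum_(iota | pairing_on [set z in flatten (flatten css)] iota &&
                 all (fun cs => stable [set z in flatten cs] iota) css)
        'X^(ncyc (iota * (cycs (flatten css) * p))) =
  'X^(ncyc p) * \prod_(cs <- css) gpoly (map size cs) :> {poly int}.
Proof.
elim: css => [|cs css IH] /= u hp.
  have := @gluing_sum_poly _ [::] p u hp; rewrite big_nil gpoly_nil => <-.
  by congr (_ * _); apply: eq_bigl => i; rewrite andbT.
move: u hp; rewrite flatten_cat; set u1 := flatten cs; set u2 := flatten (flatten css).
move=> u hp; have := u; rewrite cat_uniq => /and3P[uq1 /hasPn h12 uq2].
have h21 z : z \in u1 -> z \notin u2 by apply: contraL => /h12.
have hp1 z : z \in u1 -> p z = z by move=> hz; apply: hp; rewrite mem_cat hz.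
have hp2 z : z \in u2 -> p z = z by move=> hz; apply: hp; rewrite mem_cat hz orbT.
set U := [set z in u1]; set V := [set z in u2].
have dUV : [disjoint U & V].
  by rewrite disjoint_subset; apply/subsetP => z; rewrite !inE => /h21.
have -> : [set z in u1 ++ u2] = U :|: V by apply/setP => z; rewrite !inE mem_cat.
rewrite (eq_bigl (fun iota => [&& pairing_on (U :|: V) iota, stable U iota &
  all (fun cs => stable [set z in flatten cs] iota) css])); last by [].
rewrite (pairing_sum_prod _ _ dUV).
rewrite big_cons mulrCA -IH // size_cat count_cat.
rewrite [X in X * _](_ : _ = 'X^(size u1 + count (@nilp E) cs)
    * 'X^(size u2 + count (@nilp E) (flatten css)));
  last by rewrite -!exprD; congr (_ ^+ _); lia.
rewrite -mulrA mulrCA; rewrite [RHS]mulrCA; congr (_ * _).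
rewrite !mulr_sumr [LHS]big_mkcond [RHS]big_mkcond /=; apply: eq_bigr => i2 _.
have [h2|] := boolP (pairing_on V i2); last by [].
rewrite andTb.
have eqall i1 : pairing_on U i1 ->
  all (fun cs => stable [set z in flatten cs] (i1 * i2)) css =
  all (fun cs => stable [set z in flatten cs] i2) css.
  move=> h1; apply: eq_in_all => cs' hcs'.
  apply: eq_forallb => z; rewrite !inE; case: (boolP (z \in flatten cs')) => //= zcs.
  have zV : z \in V.
    by rewrite inE; apply/flattenP; move/flattenP: zcs => [c hc zc]; exists c => //;
       apply/flattenP; exists cs'.
  by have [_ -> //] := pairing_on_prod dUV h1 h2.
case: ifP => hall; last first.
  rewrite big_pred0 ?mulr0 // => i1; apply/negbTE/negP => /andP[h1].
  by rewrite eqall // hall.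
have hfix z : z \in u1 -> (i2 * (cycs (flatten css) * p))%g z = z.
  move=> zu; rewrite !permM (pairing_on_out h2) ?inE ?h21 // cycs_out ?h21 //.
  exact: hp1.
rewrite [RHS]mulrC -(gluing_sum_poly uq1 hfix) -/u1 -/U; congr (_ * _).
rewrite /gluing_sum; apply: eq_big => [i1|i1 h1].
  by case h1: (pairing_on U i1); rewrite //= eqall.
congr ('X^(ncyc _)); rewrite cycs_cat -!mulgA; congr (_ * _)%g.
rewrite !mulgA; congr (_ * _ * _)%g; apply/commute_sym/cycs_commute => z zu.
by rewrite (pairing_on_out h2) // inE h21.
Qed.

Lemma cyc_head y c : uniq (y :: c) -> cyc (y :: c) y = head y c.
Proof. by move=> /= /andP[yc _]; rewrite permM cyc_out // tpermL. Qed.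

(** A pairing is a product of #|U|/2 transpositions, each of which changes the
number of cycles by one; d counts those that lower it. This yields both the parity
and the upper bound for the number of vertices. *)
Lemma ncyc_pairing U iota theta : pairing_on U iota ->
  exists d, (ncyc (iota * theta) + d.*2 = ncyc theta + #|U|./2)%N.
Proof.
have [N] := ubnP #|U|; elim: N => // N IH in U iota theta * => hN h.
have [U0|[x xU]] := set_0Vmem U.
  exists 0%N; suff -> : iota = 1%g by rewrite mul1g U0 cards0 addn0.
  by apply/permP => z; rewrite (pairing_on_out h) ?perm1 // U0 inE.
have /pairing_onP/(_ x) := h; rewrite xU => -[/eqP ne _].
have yU : iota x \in U by rewrite (pairing_on_in _ h).
set y := iota x in ne yU; pose rho := (iota * tperm x y)%g.
have e : (rho * tperm x y)%g = iota by rewrite /rho -mulgA tperm2 mulg1.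
have xy : x != y by rewrite eq_sym.
have hr : pairing_on (U :\ x :\ y) rho by rewrite pairing_on_remove // e h eqxx.
have hc : #|U| = #|U :\ x :\ y|.+2.
  by rewrite (cardsD1 x U) xU (cardsD1 y (U :\ x)) !inE ne yU.
have [|d hd] := IH _ _ (tperm x y * theta)%g _ hr; first by rewrite hc in hN; lia.
rewrite mulgA e in hd.
have ht : (ncyc (tperm x y * theta) + (x \notin porbit theta y).*2 = (ncyc theta).+1)%N.
  by have := porbits_mul_tperm theta x y; rewrite /= xy addn1.
exists (d + (x \notin porbit theta y))%N.
rewrite hc /=; move: hd ht.
move: (ncyc (iota * theta)) (ncyc (tperm x y * theta)) (ncyc theta) (#|_|).
by case: (x \notin _) => /=; clear; lia.
Qed.
End Blocks.

(** The recursion treats the polygons asymmetrically; the symmetry comes from the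
interpretation of [gpoly] as a sum over the pairings of some set. *)
Lemma perm_gpoly sh sh' : perm_eq sh sh' -> gpoly sh = gpoly sh'.
Proof.
move=> h; pose N := sumn sh.
(* Faces of the prescribed sizes on the set of N edges. *)
pose cs := reshape sh (enum 'I_N).
have szN : size (enum 'I_N) = sumn sh by rewrite size_enum_ord.
have hcs : map size cs = sh.
  by rewrite -[map size _]/(shape _) reshapeKl // szN.
have fcs : flatten cs = enum 'I_N by rewrite reshapeKr // szN.
have /(perm_iotaP 0%N) [Is hI hsh'] : perm_eq sh' sh by rewrite perm_sym.
pose cs' := [seq nth [::] cs i | i <- Is].
have scs : size cs = size sh by rewrite -hcs size_map.
have hcs' : map size cs' = sh'.
  rewrite hsh' -map_comp; apply/eq_in_map => i.
  by rewrite (perm_mem hI) mem_iota -scs -hcs /= => hi; rewrite (nth_map [::]).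
have hp : perm_eq cs' cs by apply/(perm_iotaP [::]); exists Is; rewrite // scs.
have uf : uniq (flatten cs) by rewrite fcs enum_uniq.
have hpf := perm_flatten hp.
have uf' : uniq (flatten cs') by rewrite (perm_uniq hpf).
have h1 (c : seq (seq 'I_N)) :
  {in flatten c, forall z, (1%g : {perm 'I_N}) z = z} by move=> z _; rewrite perm1.
have := gluing_sum_poly uf (h1 cs); have := gluing_sum_poly uf' (h1 cs').
rewrite (perm_size hpf) (seq.permP hp) (perm_cycs uf' hp).
have -> : [set z in flatten cs'] = [set z in flatten cs].
  by apply/setP => z; rewrite !inE (perm_mem hpf).
rewrite hcs hcs' => -> /mulfI -> //.
by rewrite monic_neq0 // monicXn.
Qed.

(** An odd number of edges has no pairing. *)
Lemma gpoly_odd sh : odd (sumn sh) -> gpoly sh = 0.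
Proof.
have [N] := ubnP (sumn sh + size sh); elim: N => // N IH in sh *.
case: sh => [|[|n] sh] //= hN ho; first by rewrite gpoly0 IH ?mulr0 //; lia.
rewrite gpolyS !big1 ?addr0 // => i _; have hi := ltn_ord i.
  have hs := sumn_drop_nth hi; have hz := size_drop_nth hi.
  have [->|h0] := eqVneq (nth 0%N sh i) 0%N; first by rewrite mul0r.
  by rewrite IH ?mulr0 //=; lia.
by apply: IH => /=; lia.
Qed.

(** * Polygons, and connected gluings *)

Section Polygons.
Variables (k : nat) (m : 'I_k -> nat).
Implicit Types (iota : {perm edge m}) (i : 'I_k) (x y : edge m).

Definition block i : seq (edge m) :=
  [seq Tagged (fun i => 'I_(m i)) j | j <- enum 'I_(m i)].

Definition blocks : seq (seq (edge m)) := [seq block i | i <- enum 'I_k].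

Lemma mem_block i x : (x \in block i) = (tag x == i).
Proof.
apply/mapP/eqP => [[j _ ->] //|]; case: x => i' j /= e.
by case: i / e; exists j; rewrite ?mem_enum.
Qed.

Lemma uniq_block i : uniq (block i).
Proof.
rewrite map_inj_uniq ?enum_uniq // => a b /eqP.
by rewrite -tag_eqE /tag_eq eqxx /= tagged_asE => /eqP.
Qed.

Lemma size_block i : size (block i) = m i.
Proof. by rewrite size_map size_enum_ord. Qed.

Lemma uniq_blocks : uniq (flatten blocks).
Proof.
rewrite /blocks; have := enum_uniq 'I_k; elim: (enum 'I_k) => //= i s IH /andP[hi hs].
rewrite cat_uniq uniq_block IH // andbT.
apply/hasPn => x /flatten_mapP[j hj]; rewrite !mem_block => /eqP ->.
by apply: contraNneq hi => <-.
Qed.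

Lemma mem_blocks x : x \in flatten blocks.
Proof.
by apply/flatten_mapP; exists (tag x); rewrite ?mem_enum // mem_block.
Qed.

Lemma tau_cycs : tau m = cycs blocks.
Proof.
apply/permP => -[i j]; rewrite permE /next_edge /=.
set y : edge m := existT _ i j.
have u := uniq_blocks; rewrite /blocks in u *.
have hi : i \in enum 'I_k by rewrite mem_enum.
case/splitPr: hi u => l r; rewrite map_cat /= => u.
rewrite cycs_move // cycs_cons permM.
have u2 : uniq (flatten (block i :: [seq block i | i <- l] ++ [seq block i | i <- r])).
  have hp : perm_eq (block i :: [seq block i | i <- l] ++ [seq block i | i <- r])
      ([seq block i | i <- l] ++ block i :: [seq block i | i <- r]).
    by rewrite perm_sym -cat1s perm_catCA.
  by rewrite (perm_uniq (perm_flatten hp)).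
have hout z : z \in block i -> cycs ([seq block i | i <- l] ++ [seq block i | i <- r]) z = z.
  move=> hz; apply: cycs_out; move: u2; rewrite /= cat_uniq => /and3P[_ /hasPn h _].
  by apply: contraL hz => /h.
have tagI (n : nat) (h : (n < m i)%N) (x0 : edge m) :
    nth x0 (block i) n = Tagged (fun i => 'I_(m i)) (Ordinal h).
  rewrite (nth_map (Ordinal h)) ?size_enum_ord //; congr Tagged.
  by apply: val_inj; rewrite /= nth_enum_ord.
have hj := ltn_ord j.
have ey : y = nth y (block i) j.
  by rewrite (tagI _ hj) /y; congr existT; apply: val_inj.
have hsz := size_block i.
have eb : block i = take j (block i) ++ y :: drop j.+1 (block i).
  by rewrite ey -drop_nth ?hsz // cat_take_drop.
have -> : cyc (block i) y = Tagged (fun i => 'I_(m i)) (ordS j).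
  have ub := uniq_block i; rewrite eb in ub *.
  rewrite cyc_rot_cat // cat_cons cyc_head; last by rewrite -cat_cons uniq_catC.
  have [hlt|hge] := ltnP j.+1 (m i).
    rewrite (drop_nth y) ?hsz //= (tagI _ hlt); congr Tagged.
    by apply: val_inj; rewrite /= modn_small.
  have ej : j.+1 = m i by apply/eqP; rewrite eqn_leq hge hj.
  rewrite drop_oversize ?hsz //=.
  have h0 : (0 < m i)%N by apply: leq_trans hj.
  have -> : Tagged (fun i => 'I_(m i)) (ordS j) = nth y (block i) 0.
    by rewrite (tagI _ h0); congr Tagged; apply: val_inj; rewrite /= ej modnn.
  move: hj ej; case: (j : nat) ey => [|j'] ey hj ej.
    by rewrite take0 /= -ey.
  by rewrite -nth0 nth_take.
by rewrite hout // mem_block.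
Qed.

Lemma is_pairingE iota : is_pairing iota = pairing_on [set z in flatten blocks] iota.
Proof. by apply: eq_forallb => x; rewrite inE mem_blocks. Qed.

Definition pairing_sum (P : pred {perm edge m}) : {poly int} :=
  \sum_(iota | is_pairing iota && P iota) 'X^(ncyc (iota * tau m)).

Lemma pairing_sum_blocks css : (forall i, (0 < m i)%N) ->
  perm_eq (flatten css) blocks ->
  pairing_sum (fun iota => all (fun cs => stable [set z in flatten cs] iota) css)
  = \prod_(cs <- css) gpoly (map size cs).
Proof.
move=> hm hp; have hpf := perm_flatten hp.
have u : uniq (flatten (flatten css)) by rewrite (perm_uniq hpf) uniq_blocks.
have := @gluing_sum_blocks _ css 1%g u (fun z _ => perm1 z).
have hset : [set z in flatten (flatten css)] = [set z in flatten blocks].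
  by apply/setP => z; rewrite !inE (perm_mem hpf).
have hU : #|[set z in flatten blocks]| = #|{: edge m}|.
  by apply: eq_card => z; rewrite inE mem_blocks.
have -> : size (flatten (flatten css)) = #|{: edge m}|.
  by rewrite -hU size_flatten_set ?uniq_blocks // (perm_size hpf).
have -> : count (@nilp (edge m)) (flatten css) = 0%N.
  rewrite (seq.permP hp); apply/eqP; rewrite -leqn0 leqNgt -has_count.
  by apply/hasPn => c /mapP[i _ ->]; rewrite /nilp size_block -lt0n.
have -> : ncyc (1%g : {perm edge m}) = #|{: edge m}|.
  rewrite /ncyc /porbits card_imset // => x y.
  have e (z : edge m) : porbit 1%g z = [set z].
    apply/setP => w; rewrite inE; apply/porbitP/eqP => [[i ->]|->].
      by rewrite expg1n perm1.
    by exists 0%N; rewrite expg0 perm1.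
  by rewrite !e => /set1_inj.
rewrite addn0 mulg1 hset (perm_cycs u hp) -tau_cycs => /mulfI <- //.
  by apply: eq_bigl => iota; rewrite is_pairingE.
by rewrite monic_neq0 // monicXn.
Qed.

(** The orbit of x under the group generated by iota and tau is the smallest set
that contains x and is stable under both. *)
Lemma transitive_stableP (iota : {perm edge m}) :
  reflect (exists x : edge m, forall U : {set edge m},
             x \in U -> stable U iota -> stable U (tau m) -> U = setT)
          [transitive <<[set iota; tau m]>>%g, on [set: edge m] | 'P].
Proof.
set G := <<_>>%g.
have gen U : stable U iota -> stable U (tau m) -> (G \subset 'N(U | 'P))%g.
  move=> h1 h2; rewrite gen_subG; apply/subsetP => p.
  rewrite !inE => /orP[]/eqP ->; [have := stable_norm h1 | have := stable_norm h2];
    by rewrite !inE.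
apply: (iffP imsetP) => [[x _ e]|[x h]].
  exists x => U xU h1 h2; apply/eqP; rewrite -subTset e.
  by rewrite (acts_sub_orbit _ (gen U h1 h2)).
exists x; rewrite ?inE //; apply/esym; apply: h; first exact: orbit_refl.
all: apply/stableP => y /orbitP[p pG <-]; apply/orbitP.
- exists (p * iota)%g; last by rewrite /= /aperm permM.
  by apply: groupM => //; rewrite mem_gen ?inE ?eqxx.
- exists (p * tau m)%g; last by rewrite /= /aperm permM.
  by apply: groupM => //; rewrite mem_gen ?inE ?eqxx ?orbT.
Qed.

Definition face i : {set edge m} := [set z | tag z == i].

(** Sets that are stable under tau are unions of faces. *)
Lemma stable_tau (U : {set edge m}) x y :
  stable U (tau m) -> x \in U -> tag x = tag y -> y \in U.
Proof.
move=> /stableP h; case: x y => i a [i' b] xU /= e; case: i' / e b => b.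
have hn n (c : 'I_(m i)) : c = ((a + n) %% m i)%N :> nat -> (existT _ i c : edge m) \in U.
  elim: n c => [|n IH] c ec.
    rewrite (_ : c = a) //; apply: val_inj; rewrite /= ec addn0 modn_small //.
  have h0 : (0 < m i)%N by apply: leq_trans (ltn_ord a).
  have /h := IH (Ordinal (ltn_pmod (a + n) h0)) erefl.
  rewrite permE /next_edge /=; congr (_ \in U); congr existT; apply: val_inj.
  by rewrite /= ec -addn1 modnDml addn1 addnS.
apply: (hn (m i - a + b)%N); rewrite addnA subnKC; last exact: ltnW.
by rewrite modnDl modn_small.
Qed.

Lemma stable_face_tau i : stable (face i) (tau m).
Proof. by apply/stableP => x; rewrite !inE permE. Qed.

Lemma stableC (U : {set edge m}) iota : is_pairing iota ->
  stable U iota -> stable (~: U) iota.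
Proof.
move=> /forallP hp /stableP h; apply/stableP => x; rewrite !inE.
by apply: contra => /h; have /andP[_ /eqP ->] := hp x.
Qed.

Lemma stableI (U V : {set edge m}) (iota : {perm edge m}) :
  stable U iota -> stable V iota -> stable (U :&: V) iota.
Proof.
move=> /stableP h /stableP h'; apply/stableP => x.
by rewrite !inE => /andP[/h -> /h' ->].
Qed.

(** A partition of at most three polygons into two nonempty parts has a part
consisting of a single polygon; and if a pairing preserves a part, then it
preserves the complement. So connectivity is tested on single faces. *)
Lemma transitive_faces iota : (0 < k <= 3)%N -> (forall i, (0 < m i)%N) ->
  is_pairing iota ->
  [transitive <<[set iota; tau m]>>%g, on [set: edge m] | 'P] =
  (k == 1%N) || [forall i, ~~ stable (face i) iota].
Proof.
move=> /andP[k0 k3] hm hp.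
have [j hj] : exists j : 'I_k, true by exists (Ordinal k0).
pose e0 i : edge m := existT _ i (Ordinal (hm i)).
apply/transitive_stableP/idP => [[x h]|h].
  have [//|k1] := eqVneq k 1%N; apply/forallP => i; apply/negP => hs.
  have [i' ne] : exists i' : 'I_k, i' != i.
    pose i' := if i == Ordinal k0 then
       insubd (Ordinal k0) 1%N else Ordinal k0.
    exists i'; rewrite /i'; case: ifP => [/eqP ->|]; last by rewrite eq_sym => ->.
    by rewrite -val_eqE val_insubd; case: ifP => //; clear -k0 k1; lia.
  have [xi|xi] := boolP (x \in face i).
    have := h _ xi hs (stable_face_tau i); move/setP/(_ (e0 i')).
    by rewrite !inE /= (negbTE ne).
  have hC : stable (~: face i) (tau m).
    by apply/stableP => y; rewrite !inE permE.
  have xC : x \in ~: face i by rewrite inE.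
  have := h _ xC (stableC hp hs) hC; move/setP/(_ (e0 i)).
  by rewrite !inE /= eqxx.
exists (e0 j) => U jU hs ht.
pose I : {set 'I_k} := [set i | e0 i \in U].
have UE x : (x \in U) = (tag x \in I).
  by rewrite inE; apply/idP/idP => hx; apply: (stable_tau ht hx).
suff IT : I = setT by apply/setP => x; rewrite UE IT !inE.
have jI : j \in I by rewrite inE.
have cI := cardsC I; rewrite card_ord in cI.
have I0 : (0 < #|I|)%N by apply/card_gt0P; exists j.
case/orP: h => [/eqP k1|/forallP h].
  apply/setP => i; rewrite !inE; have -> : i = j; last by [].
  by apply: ord_inj; move: (ltn_ord i) (ltn_ord j); rewrite {2 4}k1; lia.
apply/eqP; rewrite eqEcard subsetT cardsT card_ord leqNgt; apply/negP => hlt.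
have : (#|I| == 1%N) || (#|~: I| == 1%N) by move: I0 hlt cI k3; lia.
case/orP => /cards1P[i ei]; have /negP[] := h i.
  rewrite (_ : face i = U) //; apply/setP => x; rewrite UE ei !inE //.
rewrite (_ : face i = ~: U); first exact: stableC.
by apply/setP => x; rewrite [RHS]inE UE -in_setC ei !inE.
Qed.

(** The factor 'X^(k + 2g) turns Euler's formula, which determines the number of
vertices, into an equation between natural numbers without subtraction. *)
Lemma eps_m_coef g n : (0 < k <= 3)%N -> (forall i, (0 < m i)%N) ->
  (eps_m g n m)%:R =
  ('X^(k + 2 * g) * pairing_sum (fun iota =>
     (k == 1%N) || [forall i, ~~ stable (face i) iota]))`_(n + 2) :> int.
Proof.
move=> hk hm; rewrite /pairing_sum mulr_sumr coef_sum.
rewrite (eq_bigr (fun iota => (ncyc (iota * tau m) + k + 2 * g == n + 2)%:R)); last first.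
  by move=> iota _; rewrite -exprD coefXn eq_sym addnC addnA.
rewrite /eps_m -sum1dep_card natr_sum /= big_mkcond [RHS]big_mkcond /=.
apply: eq_bigr => iota _; rewrite /is_gluing.
case hp: (is_pairing iota) => //=; rewrite transitive_faces //.
by case: (_ || _) => //=; case: (_ == _).
Qed.
End Polygons.

(** * Connected gluings as cumulants *)

(** The cumulants of order two and three of [gpoly]. *)
Definition kappa2 (a b : nat) : {poly int} := gpoly [:: a; b] - gpoly [:: a] * gpoly [:: b].

Definition kappa3 (a b c : nat) : {poly int} :=
  gpoly [:: a; b; c] - gpoly [:: a] * gpoly [:: b; c] - gpoly [:: b] * gpoly [:: a; c]
  - gpoly [:: c] * gpoly [:: a; b] + 2 * (gpoly [:: a] * gpoly [:: b] * gpoly [:: c]).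

Lemma blocks_split k (m : 'I_k -> nat) (css : seq (seq 'I_k)) :
  (forall i, (0 < m i)%N) -> perm_eq (flatten css) (enum 'I_k) ->
  pairing_sum (fun iota : {perm edge m} =>
      all (fun cs => stable [set z | tag z \in cs] iota) css)
  = \prod_(cs <- css) gpoly (map m cs).
Proof.
move=> hm hp.
have := @pairing_sum_blocks _ m (map (map (block m)) css) hm.
rewrite -map_flatten => /(_ (perm_map _ hp)).
rewrite big_map (eq_bigr (fun cs => gpoly (map m cs))) => [<-|cs _].
  apply: eq_bigl => iota; congr (_ && _); rewrite all_map.
  apply: eq_all => cs /=; congr stable; apply/setP => z; rewrite !inE.
  apply/idP/flatten_mapP => [h|[i hi]]; last by rewrite mem_block => /eqP ->.
  by exists (tag z); rewrite // mem_block.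
by congr gpoly; rewrite -map_comp; apply: eq_map => i /=; rewrite size_block.
Qed.

Lemma eq_pairing_sum k (m : 'I_k -> nat) (P Q : pred {perm edge m}) :
  (forall iota, is_pairing iota -> P iota = Q iota) ->
  pairing_sum P = pairing_sum Q.
Proof.
by move=> h; apply: eq_bigl => iota; case hp: (is_pairing iota); rewrite //= h.
Qed.

Definition o20 : 'I_2 := @Ordinal 2 0 isT.
Definition o21 : 'I_2 := @Ordinal 2 1 isT.
Definition o30 : 'I_3 := @Ordinal 3 0 isT.
Definition o31 : 'I_3 := @Ordinal 3 1 isT.
Definition o32 : 'I_3 := @Ordinal 3 2 isT.

Lemma enum_I1 : enum 'I_1 = [:: ord0].
Proof. by apply: (inj_map val_inj); rewrite val_enum_ord. Qed.

Lemma enum_I2 : enum 'I_2 = [:: o20; o21].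
Proof. by apply: (inj_map val_inj); rewrite val_enum_ord. Qed.

Lemma enum_I3 : enum 'I_3 = [:: o30; o31; o32].
Proof. by apply: (inj_map val_inj); rewrite val_enum_ord. Qed.

Lemma pairing_sum_1 (m : 'I_1 -> nat) : (forall i, (0 < m i)%N) ->
  pairing_sum (fun iota : {perm edge m} => true) = gpoly [:: m ord0].
Proof.
move=> hm; have := @blocks_split _ m [:: enum 'I_1] hm.
rewrite /= cats0 perm_refl big_seq1 enum_I1 => <- //.
apply: eq_pairing_sum => iota _; rewrite andbT; apply/esym/stableP => x _.
by rewrite !inE; case: (tag _) => [[|]].
Qed.

Lemma forall_I2 (P : pred 'I_2) : [forall i, P i] = P o20 && P o21.
Proof.
apply/forallP/andP => [h|[h0 h1] i]; first by rewrite !h.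
have : i \in enum 'I_2 by rewrite mem_enum.
by rewrite enum_I2 !inE => /orP[]/eqP ->.
Qed.

Lemma forall_I3 (P : pred 'I_3) : [forall i, P i] = [&& P o30, P o31 & P o32].
Proof.
apply/forallP/and3P => [h|[h0 h1 h2] i]; first by rewrite !h.
have : i \in enum 'I_3 by rewrite mem_enum.
by rewrite enum_I3 !inE => /or3P[]/eqP ->.
Qed.

Lemma face_seq1 k (m : 'I_k -> nat) i : [set z : edge m | tag z \in [:: i]] = face m i.
Proof. by apply/setP => z; rewrite !inE. Qed.

Lemma pairing_sumE k (m : 'I_k -> nat) (P : pred {perm edge m}) :
  pairing_sum P =
  \sum_(iota | is_pairing iota) (P iota)%:R * 'X^(ncyc (iota * tau m)).
Proof.
rewrite /pairing_sum big_mkcondr; apply: eq_bigr => iota _.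
by case: (P iota); rewrite ?mul1r ?mul0r.
Qed.

Lemma stable_compl k (m : 'I_k -> nat) (U V : {set edge m}) iota :
  is_pairing iota -> V = ~: U -> stable V iota = stable U iota.
Proof.
move=> hp ->; apply/idP/idP => h; last exact: stableC.
by rewrite -(setCK U); apply: stableC.
Qed.

Lemma stable_full k (m : 'I_k -> nat) (s : seq 'I_k) (iota : {perm edge m}) :
  (forall i, i \in s) -> stable [set z | tag z \in s] iota.
Proof. by move=> h; apply/stableP => x _; rewrite inE. Qed.

(** If one of two polygons is preserved, then so is the other. *)
Lemma pairing_sum_2 (m : 'I_2 -> nat) : (forall i, (0 < m i)%N) ->
  pairing_sum (fun iota : {perm edge m} => [forall i, ~~ stable (face m i) iota])
  = kappa2 (m o20) (m o21).
Proof.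
move=> hm.
have := @blocks_split _ m [:: enum 'I_2] hm.
have := @blocks_split _ m [:: [:: o20]; [:: o21]] hm.
rewrite !enum_I2 !big_cons !big_nil !mulr1 => /(_ isT) e2 /(_ isT) e1.
rewrite /kappa2 -[gpoly [:: _; _]]e1 -[gpoly [:: m o20] * _]e2 !pairing_sumE -sumrB.
apply: eq_bigr => iota hp; rewrite -mulrBl; congr (_ * _).
rewrite forall_I2 /= !face_seq1 !andbT stable_full; last first.
  by move=> i; rewrite -enum_I2 mem_enum.
rewrite (@stable_compl _ _ (face m o20) (face m o21)) ?andbb //.
  by case: (stable _ _); rewrite /= ?subrr ?subr0.
by apply/setP => -[[[|[|i]] hi] x]; rewrite !inE.
Qed.

(** Inclusion and exclusion: a pairing that preserves two of three polygons
preserves the third, so the disconnected pairings are those preserving polygon 1,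
2 or 3, where those preserving all of them are counted three times. *)
Lemma pairing_sum_3 (m : 'I_3 -> nat) : (forall i, (0 < m i)%N) ->
  pairing_sum (fun iota : {perm edge m} => [forall i, ~~ stable (face m i) iota])
  = kappa3 (m o30) (m o31) (m o32).
Proof.
move=> hm.
have := @blocks_split _ m [:: enum 'I_3] hm.
have := @blocks_split _ m [:: [:: o30]; [:: o31; o32]] hm.
have := @blocks_split _ m [:: [:: o31]; [:: o30; o32]] hm.
have := @blocks_split _ m [:: [:: o32]; [:: o30; o31]] hm.
have := @blocks_split _ m [:: [:: o30]; [:: o31]; [:: o32]] hm.
rewrite !enum_I3 !big_cons !big_nil !mulr1 mulrA.
move=> /(_ isT) e5 /(_ isT) e4 /(_ isT) e3 /(_ isT) e2 /(_ isT) e1.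
rewrite /kappa3 -[gpoly [:: _; _; _]]e1 -[gpoly [:: m o30] * gpoly [:: _; _]]e2.
rewrite -[gpoly [:: m o31] * gpoly [:: _; _]]e3 -[gpoly [:: m o32] * gpoly [:: _; _]]e4.
rewrite -[_ * _ * _]e5 !pairing_sumE mulr_sumr -!sumrB -big_split.
apply: eq_bigr => iota hp /=; rewrite mulrA -!mulrBl -mulrDl; congr (_ * _).
rewrite forall_I3 /= !face_seq1 !andbT stable_full; last first.
  by move=> i; rewrite -enum_I3 mem_enum.
have hc (i : 'I_3) (s : seq 'I_3) : (forall j, (j \in s) = (j != i)) ->
    stable [set z : edge m | tag z \in s] iota = stable (face m i) iota.
  by move=> h; apply: stable_compl => //; apply/setP => z; rewrite !inE h.
rewrite (hc o30); last by case=> [[|[|[|]]]].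
rewrite (hc o31); last by case=> [[|[|[|]]]].
rewrite (hc o32); last by case=> [[|[|[|]]]].
have h3 (i j l : 'I_3) : (forall o, (o == l) = (o != i) && (o != j)) ->
    stable (face m i) iota -> stable (face m j) iota -> stable (face m l) iota.
  move=> h hi hj; rewrite (_ : face m l = ~: face m i :&: ~: face m j).
    by apply: stableI; apply: stableC.
  by apply/setP => z; rewrite !inE h.
have h012 := h3 o30 o31 o32; have h021 := h3 o30 o32 o31.
have h120 := h3 o31 o32 o30.
have {}h012 : stable (face m o30) iota -> stable (face m o31) iota ->
  stable (face m o32) iota by apply: h012; case=> [[|[|[|]]]].
have {}h021 : stable (face m o30) iota -> stable (face m o32) iota ->
  stable (face m o31) iota by apply: h021; case=> [[|[|[|]]]].
have {}h120 : stable (face m o31) iota -> stable (face m o32) iota ->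
  stable (face m o30) iota by apply: h120; case=> [[|[|[|]]]].
move: h012 h021 h120.
by do 3![case: (stable _ _)] => //= h1 h2 h3'; do ?[by have := h1 isT isT
  | by have := h2 isT isT | by have := h3' isT isT]; ring.
Qed.

(** * The recursion for the numbers of gluings *)

Lemma gpoly_swap a b s : gpoly [:: a, b & s] = gpoly [:: b, a & s].
Proof. by apply: perm_gpoly; rewrite -(cat1s a) -(cat1s b) perm_catCA. Qed.

Lemma gpoly_rot3 a b c : gpoly [:: a; b; c] = gpoly [:: c; a; b].
Proof. exact: perm_gpoly (permEl (perm_catC [:: a; b] [:: c])). Qed.

Lemma kappa2_0l b : kappa2 0 b = 0.
Proof. by rewrite /kappa2 !gpoly0 gpoly_nil mulr1 subrr. Qed.

Lemma kappa2C a b : kappa2 a b = kappa2 b a.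
Proof. by rewrite /kappa2 gpoly_swap mulrC. Qed.

Lemma kappa2_0r a : kappa2 a 0 = 0. Proof. by rewrite kappa2C kappa2_0l. Qed.

(** A 0-gon is an isolated vertex; hence it is never part of a connected gluing
with other polygons. *)
Lemma kappa3_0l b c : kappa3 0 b c = 0.
Proof. by rewrite /kappa3 !gpoly0 gpoly_nil; ring. Qed.

Lemma kappa3_swap a b c : kappa3 a b c = kappa3 b a c.
Proof. by rewrite /kappa3 (gpoly_swap a b [:: c]) (gpoly_swap a b); ring. Qed.

Lemma kappa3_rot a b c : kappa3 a b c = kappa3 c a b.
Proof. by rewrite /kappa3 gpoly_rot3 (gpoly_swap b c) (gpoly_swap a c); ring. Qed.

(** The recursion for two polygons minus the one for a single polygon multiplied
by [gpoly [:: c]]. After cutting the first polygon into an a-gon and another one,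
the connected surface stays connected or falls apart in one of two ways. *)
Lemma kappa2S j c : kappa2 j.+1 c =
  \sum_(a < j) (kappa3 a (j - a.+1) c + gpoly [:: nat_of_ord a] * kappa2 (j - a.+1) c
                + gpoly [:: (j - a.+1)%N] * kappa2 a c)
  + c%:R * gpoly [:: (j + c).-1].
Proof.
rewrite /kappa2 !gpolyS /= big_ord1 big_ord0 addr0 addrAC; congr (_ + _).
rewrite mulr_suml -sumrB; apply: eq_bigr => a _.
by rewrite /kappa3; ring.
Qed.

(** Sums over all polygon sizes with 2n edges in total. Sizes zero may be included
in the second and third one, since they contribute nothing. The first one gives 'X
for n = 0, in agreement with the convention that a 0-gon glues to a sphere. *)
Definition vpoly1 (n : nat) : {poly int} := gpoly [:: (2 * n)%N].
Definition vpoly2 (n : nat) : {poly int} := \sum_(a < (2 * n).+1) kappa2 a (2 * n - a).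
Definition vpoly3 (n : nat) : {poly int} :=
  \sum_(a < (2 * n).+1) \sum_(b < (2 * n - a).+1) kappa3 a b (2 * n - a - b).

Lemma sum_even (R : nmodType) (f : nat -> R) n : (forall i, odd i -> f i = 0) ->
  \sum_(i < (2 * n).+1) f i = \sum_(i < n.+1) f (2 * i)%N.
Proof.
move=> hf; elim: n => [|n IH]; first by rewrite !big_ord1.
by rewrite mulnS big_ord_recr big_ord_recr /= IH hf ?addr0 ?[RHS]big_ord_recr ?mulnS //=; lia.
Qed.

Lemma triangle_exchange (R : nmodType) (f : nat -> nat -> R) n :
  \sum_(j < n.+1) \sum_(a < j.+1) f a (j - a)%N =
  \sum_(a < n.+1) \sum_(b < (n - a).+1) f a b.
Proof.
elim: n => [|n IH]; first by rewrite !big_ord1.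
rewrite big_ord_recr /= IH [RHS]big_ord_recr /= subnn big_ord1.
rewrite [X in _ + X]big_ord_recr /= subnn addrA; congr (_ + _).
rewrite -big_split; apply: eq_bigr => a _ /=.
by rewrite (subSn (leq_ord a)) [RHS]big_ord_recr.
Qed.

Lemma vpoly1_rec n : vpoly1 n.+1 = vpoly2 n + \sum_(i < n.+1) vpoly1 i * vpoly1 (n - i).
Proof.
rewrite /vpoly1 mulnS gpolyS /= big_ord0 addr0 /vpoly2.
rewrite (_ : \sum_(i < n.+1) _ =
  \sum_(i < (2 * n).+1) gpoly [:: nat_of_ord i] * gpoly [:: (2 * n - i)%N]).
  rewrite -big_split; apply: eq_bigr => i _ /=.
  by rewrite /kappa2 subrK; congr gpoly; congr [:: _; _]; lia.
rewrite (@sum_even _ (fun i => gpoly [:: i] * gpoly [:: (2 * n - i)%N])).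
  by apply: eq_bigr => i _; congr (_ * gpoly [:: _]); lia.
by move=> i hi; rewrite gpoly_odd ?mul0r //= addn0.
Qed.

(** The last coefficient: the merged polygon of size 2n arises from a first polygon
of size j + 1 and a second one of size c = 2n + 1 - j, whose partner edge can be
chosen in c ways; and 0 + 1 + ... + (2n + 1) = (n + 1)(2n + 1). *)
Lemma vpoly2_rec n :
  vpoly2 n.+1 = vpoly3 n + 2 * (\sum_(i < n.+1) vpoly1 i * vpoly2 (n - i))
                + (n.+1 * (2 * n).+1)%:R * vpoly1 n.
Proof.
rewrite /vpoly2 big_ord_recl kappa2_0l add0r.
rewrite (eq_bigr (fun j : 'I_(2 * n.+1) => 
   \sum_(a < j) (kappa3 a (j - a.+1) (2 * n.+1 - j.+1) 
     + gpoly [:: nat_of_ord a] * kappa2 (j - a.+1) (2 * n.+1 - j.+1)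
     + gpoly [:: (j - a.+1)%N] * kappa2 a (2 * n.+1 - j.+1))
  + (2 * n.+1 - j.+1)%:R * vpoly1 n)); last first.
  move=> j _; have hj := ltn_ord j; rewrite /= /bump add1n kappa2S.
  by congr (_ + _ * gpoly [:: _]); lia.
rewrite big_split /=; congr (_ + _); last first.
  rewrite -mulr_suml -natr_sum; congr (_%:R * _).
  (* The size of the second polygon, not that of the first, is the summation index. *)
  rewrite (reindex_inj rev_ord_inj) /=.
  rewrite (eq_bigr (fun j : 'I_(2 * n.+1) => j : nat)); last first.
    by move=> j _; have := ltn_ord j; lia.
  have tri N : (2 * \sum_(i < N) (i : nat) = N * N.-1)%N.
    elim: N => [|N IH]; rewrite ?big_ord0 // big_ord_recr mulnDr IH.
    by case: N {IH} => //= N; lia.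
  apply/eqP; rewrite -(eqn_pmul2l (isT : (0 < 2)%N)) tri mulnA; apply/eqP; congr (_ * _)%N.
  by rewrite mulnS.
rewrite mulnS big_ord_recl /= big_ord0 add0r.
rewrite (eq_bigr (fun j : 'I_(2 * n).+1 => \sum_(a < j.+1)
  (kappa3 a (j - a) (2 * n - j) + gpoly [:: nat_of_ord a] * kappa2 (j - a) (2 * n - j))
  + \sum_(a < j.+1) gpoly [:: nat_of_ord a] * kappa2 (j - a) (2 * n - j))); last first.
  move=> j _; rewrite /= /bump !add1n big_split /=; congr (_ + _).
  rewrite (reindex_inj rev_ord_inj) /=; apply: eq_bigr => a _; have ha := ltn_ord a.
  by congr (gpoly [:: _] * kappa2 _ _); lia.
rewrite big_split /=.
under eq_bigr do rewrite big_split /=.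
rewrite big_split /= -addrA -mulr2n mulr_natl; congr (_ + _ *+ 2).
  rewrite /vpoly3 -(@triangle_exchange _ (fun a b => kappa3 a b (2 * n - a - b))).
  by apply: eq_bigr => j _; apply: eq_bigr => a _; congr kappa3; have := ltn_ord a; lia.
(* Only even sizes a contribute. *)
transitivity (\sum_(a < (2 * n).+1) \sum_(b < (2 * n - a).+1)
    gpoly [:: nat_of_ord a] * kappa2 b (2 * n - a - b)).
  rewrite -(@triangle_exchange _ (fun a b => gpoly [:: a] * kappa2 b (2 * n - a - b))).
  apply: eq_bigr => j _; apply: eq_bigr => a _; have ha := ltn_ord a.
  by congr (_ * kappa2 _ _); lia.
rewrite (@sum_even _ (fun a =>
  \sum_(b < (2 * n - a).+1) gpoly [:: a] * kappa2 b (2 * n - a - b))).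
  apply: eq_bigr => i _; rewrite -mulr_sumr /vpoly1 mulnBr.
  by [].
by move=> a ha; rewrite big1 // => b _; rewrite gpoly_odd ?mul0r //= addn0.
Qed.

Lemma big_pair_sum (R : nmodType) (f : nat -> nat -> R) N M : (M < N)%N ->
  \sum_(a < N) \sum_(b < N | (a + b == M)%N) f a b = \sum_(a < M.+1) f a (M - a)%N.
Proof.
move=> h; rewrite (big_ord_widen N (fun a => f a (M - a)%N)) // [RHS]big_mkcond.
apply: eq_bigr => a _; case: ltnP => ha.
  have hb : (M - a < N)%N by lia.
  by rewrite (big_pred1 (Ordinal hb)) // => b; rewrite /= -val_eqE /=; lia.
by rewrite big_pred0 // => b; lia.
Qed.

Lemma big_triple_sum (R : nmodType) (f : nat -> nat -> nat -> R) N M : (M < N)%N ->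
  \sum_(a < N) \sum_(b < N) \sum_(c < N | (a + b + c == M)%N) f a b c =
  \sum_(a < M.+1) \sum_(b < (M - a).+1) f a b (M - a - b)%N.
Proof.
move=> h; rewrite (big_ord_widen N (fun a => \sum_(b < (M - a).+1)
  f a b (M - a - b)%N)) // [RHS]big_mkcond.
apply: eq_bigr => a _; case: ltnP => ha.
  rewrite -(@big_pair_sum _ (fun b c => f a b c) N (M - a)); last by lia.
  by apply: eq_bigr => b _; apply: eq_bigl => c; lia.
by rewrite big1 // => b _; rewrite big_pred0 // => c; lia.
Qed.

Lemma sum_ffun1 (R : nmodType) (I : finType) (f : I -> R) :
  \sum_(m : {ffun 'I_1 -> I}) f (m ord0) = \sum_a f a.
Proof.
rewrite (reindex (fun a : I => [ffun=> a])).
  by apply: eq_bigr => a _; rewrite ffunE.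
exists (fun m : {ffun 'I_1 -> I} => m ord0) => [a _|m _]; first by rewrite ffunE.
by apply/ffunP => i; rewrite ffunE (ord1 i).
Qed.

Lemma sum_ffun2 (R : nmodType) (I : finType) (f : I -> I -> R) :
  \sum_(m : {ffun 'I_2 -> I}) f (m o20) (m o21) = \sum_a \sum_b f a b.
Proof.
rewrite pair_big /=.
rewrite (reindex (fun p : I * I => [ffun i => if i == o20 then p.1 else p.2])).
  by apply: eq_bigr => -[a b] _; rewrite !ffunE.
exists (fun m : {ffun 'I_2 -> I} => (m o20, m o21)) => [[a b] _|m _].
  by rewrite !ffunE.
apply/ffunP => i; rewrite ffunE.
have : i \in enum 'I_2 by rewrite mem_enum.
by rewrite enum_I2 !inE => /orP[]/eqP ->.
Qed.

Lemma sum_ffun3 (R : nmodType) (I : finType) (f : I -> I -> I -> R) :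
  \sum_(m : {ffun 'I_3 -> I}) f (m o30) (m o31) (m o32) = \sum_a \sum_b \sum_c f a b c.
Proof.
under [RHS]eq_bigr do rewrite pair_big /=.
rewrite pair_big /=.
rewrite (reindex (fun p : I * (I * I) => [ffun i => 
  if i == o30 then p.1 else if i == o31 then p.2.1 else p.2.2])).
  by apply: eq_bigr => -[a [b c]] _; rewrite !ffunE.
exists (fun m : {ffun 'I_3 -> I} => (m o30, (m o31, m o32))) => [[a [b c]] _|m _].
  by rewrite !ffunE.
apply/ffunP => i; rewrite ffunE.
have : i \in enum 'I_3 by rewrite mem_enum.
by rewrite enum_I3 !inE => /or3P[]/eqP ->.
Qed.

Lemma forall_I1 (P : pred 'I_1) : [forall i, P i] = P ord0.
Proof. by apply/forallP/idP => [h|h i]; rewrite ?h // ord1. Qed.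

Lemma big_I1 (F : 'I_1 -> nat) : (\sum_i F i = F ord0)%N.
Proof. by rewrite big_ord1. Qed.

Lemma big_I2 (F : 'I_2 -> nat) : (\sum_i F i = F o20 + F o21)%N.
Proof. by rewrite -big_enum enum_I2 !big_cons big_nil /= addn0. Qed.

Lemma big_I3 (F : 'I_3 -> nat) : (\sum_i F i = F o30 + F o31 + F o32)%N.
Proof. by rewrite -big_enum enum_I3 !big_cons big_nil /= addn0 addnA. Qed.

Lemma eps1_coef g n : (eps g n 1)%:R = ('X^(1 + 2 * g) * vpoly1 n)`_(n + 2) :> int.
Proof.
case: n => [|n].
  rewrite /vpoly1 muln0 gpoly0 gpoly_nil mulr1 -exprSr coefXn /eps andbT.
  by case: g => [|g] //=; rewrite (_ : (_ == _) = false) //; lia.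
rewrite [eps _ _ _]/= natr_sum big_mkcond /=.
rewrite (eq_bigr (fun m : {ffun 'I_1 -> 'I_(2 * n.+1).+1} =>
  if m ord0 == ord_max then ('X^(1 + 2 * g) * vpoly1 n.+1)`_(n.+1 + 2) else 0)).
  rewrite (sum_ffun1 (fun a => if a == ord_max then _ else 0)).
  by rewrite -big_mkcond big_pred1_eq.
move=> m _; rewrite forall_I1 big_I1 -val_eqE /=.
have [e|_] := eqVneq (m ord0 : nat) (2 * n.+1)%N; last by rewrite andbF.
rewrite e /= eps_m_coef //; last by move=> i; rewrite ord1 e.
rewrite (eq_pairing_sum (Q := fun=> true)) // pairing_sum_1 ?e //.
by move=> i; rewrite ord1 e.
Qed.

Lemma eps2_coef g n : (eps g n 2)%:R = ('X^(2 + 2 * g) * vpoly2 n)`_(n + 2) :> int.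
Proof.
case: n => [|n].
  by rewrite /vpoly2 big_ord1 kappa2_0l mulr0 coef0 /eps andbF.
rewrite [eps _ _ _]/= natr_sum big_mkcond /= /vpoly2 mulr_sumr coef_sum.
rewrite -(@big_pair_sum _
  (fun a b => ('X^(2 + 2 * g) * kappa2 a b)`_(n.+1 + 2)) (2 * n.+1).+1) //.
under [RHS]eq_bigr do rewrite big_mkcond.
rewrite -(sum_ffun2 (fun a b : 'I_(2 * n.+1).+1 => 
  if (a + b == 2 * n.+1)%N then ('X^(2 + 2 * g) * kappa2 a b)`_(n.+1 + 2) else 0)).
apply: eq_bigr => m _; rewrite forall_I2 big_I2.
case: (_ == _); rewrite ?andbF // andbT; case: ifP => hm.
  have hm' i : (0 < m i)%N by move: i; apply/forallP; rewrite forall_I2.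
  by rewrite eps_m_coef // -(@pairing_sum_2 (fun i => m i)).
move/negbT: hm; rewrite negb_and -!eqn0Ngt => /orP[]/eqP ->.
  by rewrite kappa2_0l mulr0 coef0.
by rewrite kappa2_0r mulr0 coef0.
Qed.

Lemma eps3_coef g n : (eps g n 3)%:R = ('X^(3 + 2 * g) * vpoly3 n)`_(n + 2) :> int.
Proof.
case: n => [|n].
  by rewrite /vpoly3 !big_ord1 kappa3_0l mulr0 coef0 /eps andbF.
rewrite [eps _ _ _]/= natr_sum big_mkcond /= /vpoly3 mulr_sumr coef_sum.
under [RHS]eq_bigr do rewrite mulr_sumr coef_sum.
rewrite -(@big_triple_sum _
  (fun a b c => ('X^(3 + 2 * g) * kappa3 a b c)`_(n.+1 + 2)) (2 * n.+1).+1) //.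
under [RHS]eq_bigr do under eq_bigr do rewrite big_mkcond.
rewrite -(sum_ffun3 (fun a b c : 'I_(2 * n.+1).+1 => 
  if (a + b + c == 2 * n.+1)%N then ('X^(3 + 2 * g) * kappa3 a b c)`_(n.+1 + 2) else 0)).
apply: eq_bigr => m _; rewrite forall_I3 big_I3.
case: (_ == _); rewrite ?andbF // andbT; case: ifP => hm.
  have hm' i : (0 < m i)%N by move: i; apply/forallP; rewrite forall_I3.
  by rewrite eps_m_coef // -(@pairing_sum_3 (fun i => m i)).
move/negbT: hm; rewrite !negb_and -!eqn0Ngt => /or3P[]/eqP ->.
- by rewrite kappa3_0l mulr0 coef0.
- by rewrite kappa3_swap kappa3_0l mulr0 coef0.
- by rewrite kappa3_rot kappa3_0l mulr0 coef0.
Qed.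

Lemma ncyc_tau k (m : 'I_k -> nat) : (forall i, (0 < m i)%N) -> ncyc (tau m) = k.
Proof.
move=> hm; have pf x : porbit (tau m) x = face m (tag x).
  apply/setP => y; rewrite inE; apply/idP/eqP => [/porbitP[i ->]|e].
    elim: i => [|i IH]; first by rewrite expg0 perm1.
    by rewrite expgSr permM permE.
  apply: (stable_tau (x := x)) => //; last by rewrite porbit_id.
  apply/stableP => z /porbitP[i ->]; apply/porbitP; exists i.+1.
  by rewrite expgSr permM.
rewrite /ncyc -[RHS]card_ord.
rewrite (_ : porbits _ = [set face m i | i in 'I_k]).
  rewrite card_imset // => i j /setP/(_ (existT _ i (Ordinal (hm i)))).
  by rewrite !inE eqxx => /esym/eqP.
apply/setP => A; apply/imsetP/imsetP => [[x _ ->]|[i _ ->]].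
  by exists (tag x); rewrite ?pf.
by exists (existT _ i (Ordinal (hm i))); rewrite ?pf.
Qed.

(** N is the number of vertices in genus 0, and every handle costs two of them. *)
Definition genus_graded (N : nat) (p : {poly int}) : Prop :=
  forall v, p`_v != 0 -> exists d, (v + 2 * d)%N = N.

Lemma genus_graded_sum N (I : Type) (r : seq I) (P : pred I) (F : I -> {poly int}) :
  (forall i, P i -> genus_graded N (F i)) -> genus_graded N (\sum_(i <- r | P i) F i).
Proof.
move=> h; elim/big_ind: _ => // [v|p q hp hq v]; first by rewrite coef0 eqxx.
rewrite coefD; have [->|/hp //] := eqVneq p`_v 0; rewrite add0r; exact: hq.
Qed.

Lemma genus_graded_Xn N v : (exists d, (v + 2 * d)%N = N) -> genus_graded N 'X^v.
Proof. by move=> h w; rewrite coefXn; have [->|_] := eqVneq w v; rewrite ?eqxx. Qed.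

Lemma card_edge k (m : 'I_k -> nat) :
  #|[set z in flatten (blocks m)]| = (\sum_i m i)%N.
Proof.
rewrite size_flatten_set ?uniq_blocks // size_flatten /shape /blocks -map_comp.
rewrite sumnE big_map -big_enum; apply: eq_bigr => i _ /=; exact: size_block.
Qed.

Lemma vpoly1_graded n : genus_graded n.+1 (vpoly1 n).
Proof.
rewrite /vpoly1; case: n => [|n].
  by rewrite muln0 gpoly0 gpoly_nil mulr1 -['X]expr1; apply: genus_graded_Xn; exists 0%N.
pose m (i : 'I_1) := (2 * n.+1)%N; have hm i : (0 < m i)%N by [].
rewrite -[gpoly _]/(gpoly [:: m ord0]) -pairing_sum_1 //; apply: genus_graded_sum => iota.
rewrite andbT is_pairingE => /(ncyc_pairing (tau m)) [d +].
rewrite card_edge big_I1 ncyc_tau // -[m _]/(2 * n.+1)%N [(2 * n.+1)%N]mul2n doubleK.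
by move=> h; apply: genus_graded_Xn; exists d; rewrite mul2n h add1n.
Qed.

(** The transposition of an edge x of the first polygon and its partner in the
second one merges the two faces; the remaining n - 1 transpositions raise the
number of cycles from 1 to at most n. *)
Lemma kappa2_graded n a b : (a + b = 2 * n)%N -> genus_graded n (kappa2 a b).
Proof.
case: a => [|a]; first by move=> _ v; rewrite kappa2_0l coef0 eqxx.
case: b => [|b]; first by move=> _ v; rewrite kappa2_0r coef0 eqxx.
move=> hab; pose m (i : 'I_2) := if i == o20 then a.+1 else b.+1.
have hm i : (0 < m i)%N by rewrite /m; case: ifP.
rewrite -[kappa2 _ _]/(kappa2 (m o20) (m o21)) -pairing_sum_2 //.
apply: genus_graded_sum => iota; rewrite forall_I2 => /andP[hp /andP[hs _]].
move: hs; rewrite /stable negb_forall => /existsP[x].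
rewrite negb_imply !inE => /andP[/eqP tx ty].
set y := iota x in ty.
have xy : x != y by apply: contraNneq ty => <-; apply/eqP.
set U := [set z in flatten (blocks m)].
have memU z : z \in U by rewrite inE mem_blocks.
have hP : pairing_on U iota by rewrite -is_pairingE.
have hr : pairing_on (U :\ x :\ y) (iota * tperm x y).
  by rewrite pairing_on_remove // -mulgA tperm2 mulg1 hP eqxx.
have [d hd] := ncyc_pairing (tperm x y * tau m) hr.
rewrite -mulgA (mulgA (tperm x y)) tperm2 mul1g in hd.
have hc : #|U :\ x :\ y| = (2 * n - 2)%N.
  have := card_edge m; rewrite -/U big_I2 {1}/m /m /= hab => <-.
  have c1 := cardsD1 x U; have c2 := cardsD1 y (U :\ x).
  have yU1 : y \in U :\ x by rewrite !inE mem_blocks eq_sym xy.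
  by rewrite -> yU1 in c2; rewrite -> (memU x) in c1; rewrite c1 c2 !add1n subn2.
have ht : (ncyc (tperm x y * tau m)) = 1%N.
  have := porbits_mul_tperm (tau m) x y; rewrite /= xy -/(ncyc _) -/(ncyc (tau m)).
  rewrite (_ : x \notin _); first by rewrite ncyc_tau //; lia.
  apply/negP => /porbitP[i ex]; move: ty; rewrite -tx ex => /eqP[].
  elim: (i) => [|j IH]; first by rewrite expg0 perm1.
  by rewrite expgSr permM [tau m _]permE.
apply: genus_graded_Xn; exists d; move: hd; rewrite ht hc -[(2 * n - 2)%N]/(2 * n - 2 * 1)%N.
by rewrite -mulnBr mul2n doubleK; move: (ncyc _) => v; clear -hab; lia.
Qed.

Lemma vpoly2_graded n : genus_graded n (vpoly2 n).
Proof.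
apply: genus_graded_sum => a _; apply: kappa2_graded.
by have := ltn_ord a; lia.
Qed.

Lemma genus_expand N p H : genus_graded N p -> (N < H)%N ->
  p = \sum_(h < H) ('X^(2 * h) * p)`_N *: 'X^(N - 2 * h).
Proof.
move=> hg hH; apply/polyP => v; rewrite coef_sum.
under eq_bigr do rewrite coefZ coefXn coefXnM.
have [e|/[dup] hv /hg [d hd]] := eqVneq p`_v 0.
  rewrite big1 // => h _; case: ltnP => hh; first by rewrite mul0r.
  by case: eqP => ev; rewrite ?mulr0 // -ev e mul0r.
have hdH : (d < H)%N by lia.
rewrite (bigD1 (Ordinal hdH)) //= big1 ?addr0 => [|h].
  have -> : (N < 2 * d)%N = false by lia.
  by rewrite -hd addnK eqxx mulr1.
rewrite -val_eqE /= => hne; case: ltnP => hh; first by rewrite mul0r.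
by have -> : (v == N - 2 * h)%N = false; [lia | rewrite mulr0].
Qed.

(** The genus is additive in products. The shift by 'X^(2 * h) reads off the part of
genus h, and gives 0 for those h that exceed the possible genus. *)
Lemma genus_graded_mul a b p q G : genus_graded a p -> genus_graded b q ->
  ('X^(2 * G) * (p * q))`_(a + b) =
  \sum_(h < G.+1) ('X^(2 * h) * p)`_a * ('X^(2 * (G - h)) * q)`_b.
Proof.
move=> hp hq; pose H := (a + b + G).+1.
have haH : (a < H)%N by rewrite /H; lia.
have hbH : (b < H)%N by rewrite /H; lia.
set c := fun h => ('X^(2 * h) * p)`_a; set d := fun h => ('X^(2 * h) * q)`_b.
have c0 h : (a < 2 * h)%N -> c h = 0 by move=> lt; rewrite /c coefXnM lt.
have d0 h : (b < 2 * h)%N -> d h = 0 by move=> lt; rewrite /d coefXnM lt.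
have -> : p * q = (\sum_(h < H) c h *: 'X^(a - 2 * h)) *
                  (\sum_(h < H) d h *: 'X^(b - 2 * h)).
  by rewrite -(genus_expand hp haH) -(genus_expand hq hbH).
transitivity (\sum_(h < G.+1) c h * d (G - h)%N); last by [].
rewrite (big_ord_widen H (fun h => c h * d (G - h)%N)); last by rewrite /H; lia.
rewrite [RHS]big_mkcond mulr_suml mulr_sumr coef_sum; apply: eq_bigr => h _.
rewrite mulr_sumr mulr_sumr coef_sum.
rewrite (eq_bigr (fun h' : 'I_H => if (h + h' == G)%N then c h * d h' else 0)); last first.
  move=> h' _; rewrite -scalerAl -!scalerAr scalerA coefZ -!exprD coefXn.
  have [lt|le] := ltnP a (2 * h); first by rewrite c0 ?mul0r //; case: ifP.
  have [lt|le'] := ltnP b (2 * h'); first by rewrite d0 ?mulr0 ?mul0r //; case: ifP.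
  case: eqP => e.
    by rewrite (_ : (_ == _) = true) ?mulr1 //; lia.
  by rewrite (_ : (_ == _) = false) ?mulr0 //; lia.
(* For fixed h, the only surviving index is h' = G - h. *)
rewrite -big_mkcond; case: ltnP => hG.
  have hlt : (G - h < H)%N by rewrite /H; lia.
  by rewrite (big_pred1 (Ordinal hlt)) // => h'; rewrite /= -val_eqE /=; lia.
by rewrite big_pred0 // => h'; lia.
Qed.

Lemma natr_int_inj : injective (fun n : nat => n%:R : int).
Proof. by move=> a b /eqP; rewrite eqr_nat => /eqP. Qed.

(** The Catalan recursion. The connected part of the division of the polygon would
have genus -1, so it does not contribute. *)
Lemma eps1_genus0_rec n :
  eps 0 n.+1 1 = (\sum_(i < n.+1) eps 0 i 1 * eps 0 (n - i) 1)%N.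
Proof.
apply: natr_int_inj; rewrite eps1_coef vpoly1_rec mulrDr coefD natr_sum.
rewrite !coefXnM /= muln0 addn0 addn2 /= subn1 /=.
have -> : (vpoly2 n)`_n.+2 = 0.
  by apply/eqP/negPn/negP => /vpoly2_graded [d]; lia.
rewrite add0r coef_sum; apply: eq_bigr => i _; have hi := ltn_ord i.
have := genus_graded_mul 0 (@vpoly1_graded i) (@vpoly1_graded (n - i)).
rewrite muln0 expr0 mul1r big_ord1 /= !mul1r.
rewrite (_ : (i.+1 + (n - i).+1)%N = n.+2); last by lia.
by move=> ->; rewrite natrM !eps1_coef !coefXnM /= !addn2 !subn1.
Qed.

Lemma eps2_rec g n :
  eps g.+1 n.+1 2 =
  (eps g n 3 + 2 * \sum_(i < n.+1) \sum_(h < g.+2) eps h i 1 * eps (g.+1 - h) (n - i) 2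
   + n.+1 * (2 * n).+1 * eps g.+1 n 1)%N.
Proof.
apply: natr_int_inj; rewrite eps2_coef vpoly2_rec !mulrDr !coefD.
rewrite natrD (natrD _ (eps g n 3)).
have shift j (p : {poly int}) M : ('X^(j.+1) * p)`_M.+1 = ('X^j * p)`_M.
  by rewrite !coefXnM ltnS subSS.
congr (_ + _ + _).
- by rewrite eps3_coef mulnS addSn shift.
- rewrite mulrCA natrM mulr_natl mulr_natl coefMn; congr (_ *+ 2).
  rewrite mulr_sumr coef_sum natr_sum; apply: eq_bigr => i _; have hi := ltn_ord i.
  rewrite addn2 add2n 2!shift.
  have := genus_graded_mul g.+1 (@vpoly1_graded i) (@vpoly2_graded (n - i)).
  rewrite (_ : (i.+1 + (n - i))%N = n.+1); last by lia.
  move=> ->; rewrite natr_sum; apply: eq_bigr => h _; rewrite natrM eps1_coef eps2_coef.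
  by rewrite !addn2 add1n add2n 3!shift.
- rewrite mulrCA mulr_natl natrM mulr_natl coefMn eps1_coef; congr (_ *+ _).
  by rewrite !addn2 add1n add2n 3!shift.
Qed.

Lemma eps2_n0 g : eps g 0 2 = 0%N. Proof. by rewrite /eps andbF. Qed.

Lemma eps1_n0 g : eps g 0 1 = (g == 0)%N. Proof. by rewrite /eps andbT. Qed.

Lemma eps2_g0_n1 : eps 0 1 2 = 1%N.
Proof.
apply: natr_int_inj; rewrite eps2_coef /vpoly2 !big_ord_recl big_ord0.
rewrite kappa2_0l kappa2_0r /bump /= add0r !addr0 /kappa2 !gpolyS /= !big_ord1 !big_ord0.
by rewrite !add0r mul0r subr0 mul1r gpoly0 gpoly_nil mulr1 -exprSr coefXn.
Qed.

(** * Formal power series and the powers of 1 - 4z *)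

(** An alias that carries the ring structure with the Cauchy product [fps_mul]. *)
Definition series : Type := fps.
HB.instance Definition _ := gen_eqMixin series.
HB.instance Definition _ := gen_choiceMixin series.

(** Identities for products of series are inherited from polynomials: a coefficient
of a product involves only finitely many coefficients of the factors. *)
Definition trunc (N : nat) (a : series) : {poly rat} := \poly_(i < N) a i.

Lemma coef_trunc N a i : (i < N)%N -> (trunc N a)`_i = a i.
Proof. by move=> h; rewrite coef_poly h. Qed.

Lemma fps_mul_trunc N a b n : (n < N)%N ->
  fps_mul a b n = (trunc N a * trunc N b)`_n.
Proof.
move=> h; rewrite coefM; apply: eq_bigr => i _; have hi := ltn_ord i.
by rewrite !coef_trunc //; lia.
Qed.

Definition series_add (a b : series) : series := fun n => a n + b n.
Definition series_opp (a : series) : series := fun n => - a n.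
Definition series_cst (r : rat) : series := fun n => if n is 0%N then r else 0.

Lemma series_addA : associative series_add.
Proof. by move=> a b c; apply/funext => n; rewrite /series_add addrA. Qed.

Lemma series_addC : commutative series_add.
Proof. by move=> a b; apply/funext => n; rewrite /series_add addrC. Qed.

Lemma series_add0 : left_id (series_cst 0) series_add.
Proof. by move=> a; apply/funext => -[|n]; rewrite /series_add add0r. Qed.

Lemma series_addN : left_inverse (series_cst 0) series_opp series_add.
Proof. by move=> a; apply/funext => -[|n]; rewrite /series_add addNr. Qed.

HB.instance Definition _ :=
  GRing.isZmodule.Build series series_addA series_addC series_add0 series_addN.

Lemma series_mulA : associative (fps_mul : series -> series -> series).
Proof.
move=> a b c; apply/funext => n.
rewrite [LHS]/fps_mul [RHS]/fps_mul.
transitivity ((trunc n.+1 a * (trunc n.+1 b * trunc n.+1 c))`_n).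
  rewrite coefM; apply: eq_bigr => i _; have hi := ltn_ord i.
  by rewrite coef_trunc // -fps_mul_trunc //; lia.
rewrite mulrA coefM; apply: eq_bigr => i _; have hi := ltn_ord i.
by rewrite -fps_mul_trunc // coef_trunc //; lia.
Qed.

Lemma series_mulC : commutative (fps_mul : series -> series -> series).
Proof.
move=> a b; apply/funext => n.
by rewrite !(@fps_mul_trunc n.+1) // mulrC.
Qed.

Lemma series_cst_mul r a : fps_mul (series_cst r) a = (fun n => r * a n) :> series.
Proof.
apply/funext => n; rewrite /fps_mul big_ord_recl subn0 big1 ?addr0 //=.
by move=> i _; rewrite mul0r.
Qed.

Lemma series_mul1 : left_id (series_cst 1) (fps_mul : series -> series -> series).
Proof. by move=> a; rewrite series_cst_mul; apply/funext => n; rewrite mul1r. Qed.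

Lemma series_mulDl :
  left_distributive (fps_mul : series -> series -> series) series_add.
Proof.
move=> a b c; apply/funext => n; rewrite /fps_mul /series_add -big_split /=.
by apply: eq_bigr => i _; rewrite mulrDl.
Qed.

Lemma series_1neq0 : (series_cst 1 != 0 :> series).
Proof. by apply/eqP => /(congr1 (fun a => a 0%N)) /eqP; rewrite oner_eq0. Qed.

HB.instance Definition _ := GRing.Zmodule_isComNzRing.Build series
  series_mulA series_mulC series_mul1 series_mulDl series_1neq0.

Lemma seriesD (a b : series) n : (a + b) n = a n + b n. Proof. by []. Qed.

Lemma seriesM (a b : series) n : (a * b) n = fps_mul a b n. Proof. by []. Qed.

Lemma seriesB (a b : series) n : (a - b) n = a n - b n. Proof. by []. Qed.

Lemma series1S n : (1 : series) n.+1 = 0. Proof. by []. Qed.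

Lemma series0 n : (0 : series) n = 0. Proof. by case: n. Qed.

Lemma seriesMn (a : series) k n : (a *+ k) n = a n *+ k.
Proof. by elim: k => [|k IH]; [rewrite !mulr0n series0 | rewrite !mulrS seriesD IH]. Qed.

Lemma series_sum (I : Type) (r : seq I) (F : I -> series) n :
  (\sum_(i <- r) F i) n = \sum_(i <- r) F i n.
Proof. by elim/big_rec2: _ => [|i y x _ <-]; rewrite ?series0. Qed.

Lemma series_cst_is_additive : zmod_morphism series_cst.
Proof. by move=> r s; apply/funext => -[|n] //=; rewrite seriesD /= addr0. Qed.

Lemma series_cst_is_multiplicative : monoid_morphism series_cst.
Proof.
split=> // r s; apply/funext => n; rewrite seriesM series_cst_mul.
by case: n => //= n; rewrite mulr0.
Qed.

HB.instance Definition _ :=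
  GRing.isZmodMorphism.Build rat series series_cst series_cst_is_additive.
HB.instance Definition _ :=
  GRing.isMonoidMorphism.Build rat series series_cst series_cst_is_multiplicative.

Definition poly_series (p : {poly int}) : series := fps_poly p.

Lemma poly_series_is_additive : zmod_morphism poly_series.
Proof.
move=> p q; apply/funext => n; rewrite seriesD /poly_series /fps_poly coefB rmorphB //.
Qed.

Lemma poly_series_is_multiplicative : monoid_morphism poly_series.
Proof.
split.
  by apply/funext => -[|n]; rewrite /poly_series /fps_poly coef1.
move=> p q; apply/funext => n; rewrite seriesM /poly_series /fps_poly coefM rmorph_sum.
by apply: eq_bigr => i _; rewrite rmorphM.
Qed.

HB.instance Definition _ := GRing.isZmodMorphism.Build {poly int} series
  poly_series poly_series_is_additive.
HB.instance Definition _ := GRing.isMonoidMorphism.Build {poly int} series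
  poly_series poly_series_is_multiplicative.

Definition zvar : series := poly_series 'X.

Lemma zvarM0 a : (zvar * a) 0%N = 0.
Proof. by rewrite seriesM /fps_mul big_ord1 /zvar /poly_series /fps_poly coefX mul0r. Qed.

Lemma zvarMS a n : (zvar * a) n.+1 = a n.
Proof.
rewrite seriesM /fps_mul !big_ord_recl big1 => [|i _].
  by rewrite /zvar /poly_series /fps_poly !coefX /= mul0r add0r addr0 mul1r /bump /= subn1.
by rewrite /zvar /poly_series /fps_poly coefX /= mul0r.
Qed.

Lemma zvar_inj : injective ( *%R zvar).
Proof.
move=> a b h; apply/funext => n; have := congr1 (fun s : series => s n.+1) h.
by rewrite !zvarMS.
Qed.

(** Used to choose between the two square roots of a series by their constant
terms. *)
Lemma series_mul_eq0 (a b : series) : a * b = 0 -> b 0%N != 0 -> a = 0.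
Proof.
move=> h b0; apply/funext => n; rewrite series0.
have [N] := ubnP n; elim: N n => // N IH n hn.
have := congr1 (fun s : series => s n) h.
rewrite /= series0 seriesM /fps_mul big_ord_recr /= subnn big1 ?add0r.
  by move/eqP; rewrite mulf_eq0 (negbTE b0) orbF => /eqP.
by move=> i _; rewrite IH ?mul0r //; have := ltn_ord i; lia.
Qed.

Lemma series_cstM r (a : series) n : (series_cst r * a) n = r * a n.
Proof. by rewrite seriesM series_cst_mul. Qed.

Definition sderiv (a : series) : series := fun n => a n.+1 *+ n.+1.

Lemma sderivD a b : sderiv (a + b) = sderiv a + sderiv b.
Proof. by apply/funext => n; rewrite seriesD /sderiv -mulrnDl. Qed.

Lemma sderiv_trunc N a i : (i.+1 < N)%N -> (trunc N a)^`()`_i = sderiv a i.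
Proof. by move=> h; rewrite coef_deriv coef_trunc. Qed.

Lemma sderivM a b : sderiv (a * b) = sderiv a * b + a * sderiv b.
Proof.
apply/funext => n; rewrite seriesD [LHS]/sderiv seriesM (@fps_mul_trunc n.+2) //.
rewrite -coef_deriv derivM coefD !coefM; congr (_ + _); apply: eq_bigr => i _;
  have hi := ltn_ord i; rewrite sderiv_trunc ?coef_trunc //; lia.
Qed.

Lemma sderiv_poly p : sderiv (poly_series p) = poly_series p^`().
Proof.
apply/funext => n; rewrite /sderiv /poly_series /fps_poly coef_deriv.
by rewrite rmorphMn.
Qed.

Definition pow_series (a : rat) : series := pow_1m4z a.
Definition one_sub_4z : series := poly_series (1 - 4 * 'X).

Lemma one_sub_4zE : one_sub_4z = 1 - 4 * zvar.
Proof. by rewrite /one_sub_4z rmorphB rmorph1 rmorphM rmorph_nat. Qed.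

Lemma one_sub_4zM (a : series) n : (one_sub_4z * a) n = a n - 4 * (zvar * a) n.
Proof. by rewrite one_sub_4zE mulrBl mul1r seriesB -mulrA !mulr_natl seriesMn. Qed.

Lemma pow_series_coef0 a : pow_series a 0%N = 1.
Proof. by rewrite /pow_series /pow_1m4z expr0 big_ord0 fact0 mulr1 divr1. Qed.

Lemma factV_neq0 n : (n`!%:R : rat) != 0.
Proof. by rewrite pnatr_eq0 -lt0n fact_gt0. Qed.

Lemma sderiv_pow_series a : sderiv (pow_series a) = series_cst (- 4 * a) * pow_series (a - 1).
Proof.
apply/funext => n; rewrite series_cstM /sderiv /pow_series /pow_1m4z.
rewrite exprS big_ord_recl /= subr0 factS natrM -mulr_natr.
have -> : \prod_(i < n) (a - (bump 0 i)%:R) = \prod_(j < n) (a - 1 - j%:R).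
  by apply: eq_bigr => i _; rewrite /bump /= natrD opprD addrA.
have h1 : (n.+1%:R : rat) != 0 by rewrite pnatr_eq0.
by field; rewrite factV_neq0 nat1r h1.
Qed.

(** The differential equation of (1 - 4z)^a; together with the constant term it
determines this series. *)
Definition pow_ode (a : rat) (f : series) : Prop :=
  one_sub_4z * sderiv f = series_cst (- 4 * a) * f.

Lemma pow_ode_coef a f : pow_ode a f ->
  forall n, f n.+1 *+ n.+1 = (4 * n%:R - 4 * a) * f n.
Proof.
move=> h n; have := congr1 (fun s : series => s n) h.
rewrite /= one_sub_4zM series_cstM.
case: n => [|n]; first by rewrite zvarM0 /sderiv mulr0 subr0 => ->; ring.
by rewrite zvarMS {1}/sderiv => /(canRL (subrK _)) ->; rewrite /sderiv; ring.
Qed.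

Lemma pow_ode_unique a f g : f 0%N = g 0%N -> pow_ode a f -> pow_ode a g -> f = g.
Proof.
move=> h0 /pow_ode_coef hf /pow_ode_coef hg; apply/funext; elim=> // n IH.
have h1 : (n.+1%:R : rat) != 0 by rewrite pnatr_eq0.
apply: (mulIf h1); rewrite !mulr_natr.
exact: etrans (hf n) (etrans (congr1 _ IH) (esym (hg n))).
Qed.

Lemma pow_series_odeP a : pow_ode a (pow_series a).
Proof.
rewrite /pow_ode; apply/funext => n; rewrite one_sub_4zM series_cstM.
have step k : sderiv (pow_series a) k = (4 * k%:R - 4 * a) * pow_series a k.
  rewrite /sderiv /pow_series /pow_1m4z exprSr big_ord_recr /= factS natrM -mulr_natr.
  have h1 : (k.+1%:R : rat) != 0 by rewrite pnatr_eq0.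
  by field; rewrite factV_neq0 nat1r h1.
case: n => [|n]; first by rewrite zvarM0 step; ring.
by rewrite zvarMS step /sderiv; ring.
Qed.

(** Both sides solve the same differential equation. *)
Lemma pow_seriesD a b : pow_series a * pow_series b = pow_series (a + b).
Proof.
apply: (@pow_ode_unique (a + b)); last exact: pow_series_odeP.
  by rewrite seriesM /fps_mul big_ord1 subnn !pow_series_coef0 mul1r.
have ha := pow_series_odeP a; have hb := pow_series_odeP b; rewrite /pow_ode in ha hb *.
rewrite sderivM mulrDr mulrA ha (mulrCA _ (pow_series a)) hb mulrDr rmorphD /=.
by ring.
Qed.

Lemma pow_series1 : pow_series 1 = one_sub_4z.
Proof.
apply: (@pow_ode_unique 1); [|exact: pow_series_odeP|].
  by rewrite pow_series_coef0 one_sub_4zE seriesB mulrC zvarM0 subr0.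
rewrite /pow_ode /one_sub_4z sderiv_poly mulrC; congr (_ * _).
rewrite derivB -[1]/(1%:P) derivC mulr_natl derivMn derivX sub0r mulr1.
by rewrite !rmorphN !rmorph_nat.
Qed.

(** * The generating functions *)

Definition C_series (k g : nat) : series := C k g.

Lemma C_series_catalan : C_series 1 0 = 1 + zvar * (C_series 1 0 * C_series 1 0).
Proof.
apply/funext => -[|n]; rewrite seriesD.
  by rewrite zvarM0 addr0 /C_series /C eps1_n0.
rewrite zvarMS /C_series /C eps1_genus0_rec seriesM /fps_mul natr_sum.
rewrite [X in X + _]series1S add0r.
by apply: eq_bigr => i _; rewrite natrM.
Qed.

(** The equation C_0 = 1 + z C_0^2 says that the square of the left-hand side is
1 - 4z; the sum of the two square roots has constant term 2. *)
Lemma C_series_sqrt : 1 - 2 * (zvar * C_series 1 0) = pow_series (1 / 2).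
Proof.
set u := LHS; set s := pow_series _.
have hs : s * s = one_sub_4z.
  by rewrite /s pow_seriesD -pow_series1; congr pow_series; field.
have hu : u * u = one_sub_4z.
  rewrite one_sub_4zE /u; set z := zvar; set c := C_series 1 0.
  have e : c = 1 + z * (c * c) by exact: C_series_catalan.
  transitivity (1 - 4 * (z * (c - z * (c * c)))); first by ring.
  by rewrite {1}e; ring.
apply/eqP; rewrite -subr_eq0; apply/eqP.
apply: (@series_mul_eq0 _ (u + s)).
  transitivity (u * u - s * s); first by ring.
  by rewrite hu hs subrr.
rewrite seriesD /s pow_series_coef0 /u seriesB mulrCA zvarM0 subr0.
by [].
Qed.

Lemma series_natM k (a : series) n : (k%:R * a) n = k%:R * a n.
Proof. by rewrite !mulr_natl seriesMn. Qed.

Lemma zvar_sderiv a n : (zvar * sderiv a) n = n%:R * a n.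
Proof.
case: n => [|n]; first by rewrite zvarM0 mul0r.
by rewrite zvarMS /sderiv mulr_natl.
Qed.

Lemma zvar_sderiv2 a n :
  (zvar * (zvar * sderiv (sderiv a))) n = n%:R * (n%:R - 1) * a n.
Proof.
case: n => [|n]; first by rewrite zvarM0 !mul0r.
by rewrite zvarMS zvar_sderiv /sderiv -mulr_natr; ring.
Qed.

(** The operator 2 z^2 D^2 + 5 z D + 1 multiplies the coefficient of z^n by
2 n (n - 1) + 5 n + 1 = (n + 1) (2 n + 1). *)
Lemma C_series_rec g : C_series 2 g.+1 =
  zvar * (C_series 3 g + 2 * (\sum_(h < g.+2) C_series 1 h * C_series 2 (g.+1 - h))
  + (2 * (zvar * (zvar * sderiv (sderiv (C_series 1 g.+1))))
            + 5 * (zvar * sderiv (C_series 1 g.+1)) + C_series 1 g.+1)).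
Proof.
apply/funext => -[|n]; first by rewrite zvarM0 /C_series /C eps2_n0.
rewrite zvarMS !seriesD !series_natM zvar_sderiv2 zvar_sderiv series_sum.
rewrite {1 2 4 5 6}/C_series /C eps2_rec natrD (natrD _ (eps g n 3)); congr (_ + _ + _).
  rewrite natrM; congr (_ * _); rewrite exchange_big natr_sum; apply: eq_bigr => h _.
  rewrite seriesM /fps_mul natr_sum; apply: eq_bigr => i _.
  by rewrite natrM.
by rewrite !natrM -[(2 * n).+1]addn1 natrD natrM -[n.+1]addn1 natrD; ring.
Qed.

Lemma Xn_dvdP (p : {poly int}) n :
  (exists q, p = 'X^n * q) <-> (forall i, (i < n)%N -> p`_i = 0).
Proof.
split=> [[q ->] i hi|h]; first by rewrite coefXnM hi.
exists (drop_poly n p); rewrite mulrC -[LHS](poly_take_drop n).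
rewrite (_ : take_poly n p = 0) ?add0r //.
by apply/polyP => i; rewrite coef_take_poly coef0; case: ltnP => // /h.
Qed.

(** The differential operator 2 z^2 D^2 + 5 z D + 1 transported to the numerator p of
p / (1 - 4z)^(3g+5/2), plus the term 2 z p that comes from the product of C_(g+1)
with C_0^[2]. *)
Definition face_op (g : nat) (p : {poly int}) : {poly int} :=
  2 * 'X^2 * (1 - 4 * 'X) ^+ 2 * p^`(2)
  + ((48 * g + 20)%:R * 'X + 5) * 'X * (1 - 4 * 'X) * p^`()
  + ((48 * (2 * g + 1) * (3 * g + 2))%:R * 'X^2 + (60 * g + 44)%:R * 'X + 1) * p.

Lemma coef_X_deriv (p : {poly int}) i : ('X * p^`())`_i = i%:R * p`_i.
Proof.
by rewrite coefXM; case: i => [|i] /=; rewrite ?mul0r // coef_deriv mulr_natl.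
Qed.

Lemma coef_X2_deriv2 (p : {poly int}) i :
  ('X^2 * p^`(2))`_i = i%:R * (i%:R - 1) * p`_i.
Proof.
rewrite expr2 -mulrA derivSn derivn1; case: i => [|i]; first by rewrite coefXM !mul0r.
by rewrite coefXM /= coef_X_deriv coef_deriv -mulr_natr; ring.
Qed.

(** In terms of the Euler operator z D, which is diagonal on monomials, the operator
has three parts of degree 0, 1 and 2; the part of degree 2 kills z^(3g+2). *)
Lemma coef_face_op g p : exists T0 T1 : nat -> int,
  forall i, (face_op g p)`_i = T0 i * p`_i
   + (if i is j.+1 then T1 j * p`_j else 0)
   + (if i is j.+2 then
        16 * (j%:R - (3 * g + 2)%:R) * (2 * j%:R - 3 * (2 * g + 1)%:R) * p`_j else 0).
Proof.
(* The building blocks that act diagonally on monomials. *)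
pose A := 'X^2 * p^`(2); pose B := 'X * p^`().
pose k1 : int := (48 * (2 * g + 1) * (3 * g + 2))%:R.
pose k2 : int := (60 * g + 44)%:R.
pose k3 : int := (48 * g + 20)%:R.
pose T a b c := a%:P * A + b%:P * B + c%:P * p.
have coefT a b c i : (T a b c)`_i = (a * (i%:R * (i%:R - 1)) + b * i%:R + c) * p`_i.
  by rewrite /T !coefD !coefCM coef_X_deriv coef_X2_deriv2; ring.
have e : face_op g p = T 2 5 1 + 'X * T (-16) (k3 - 20) k2 + 'X * ('X * T 32 (-4 * k3) k1).
  rewrite /T /A /B /face_op /k1 /k2 /k3 !rmorphN !rmorphB /=.
  rewrite !rmorphM /= !rmorphN /= !rmorph_nat.
  by ring.
exists (fun i => 2 * (i%:R * (i%:R - 1)) + 5 * i%:R + 1).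
exists (fun i => -16 * (i%:R * (i%:R - 1)) + (k3 - 20) * i%:R + k2) => i.
clearbody T; rewrite e !coefD coefT; congr (_ + _ + _).
  by rewrite coefXM; case: i => [|i] //=; rewrite coefT.
rewrite !coefXM; case: i => [|[|j]] //=; rewrite coefT; congr (_ * _).
rewrite /k1 /k3 !natrD !natrM !natrD; ring.
Qed.

Lemma sderivMn a n : sderiv (a *+ n) = sderiv a *+ n.
Proof. by apply/funext => i; rewrite /sderiv seriesMn [RHS]seriesMn mulrnAC. Qed.

Lemma poly_series_face_op g p :
  poly_series (face_op g p) =
  2 * zvar ^+ 2 * one_sub_4z ^+ 2 * poly_series p^`()^`()
  + ((48 * g + 20)%:R * zvar + 5) * zvar * one_sub_4z * poly_series p^`()
  + ((48 * (2 * g + 1) * (3 * g + 2))%:R * zvar ^+ 2 + (60 * g + 44)%:R * zvar + 1)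
    * poly_series p.
Proof.
have psD a b : poly_series (a + b) = poly_series a + poly_series b by exact: rmorphD.
have psM a b : poly_series (a * b) = poly_series a * poly_series b by exact: rmorphM.
have psn n : poly_series n%:R = n%:R by exact: rmorph_nat.
have gen (a b c d e x y p0 p1 p2 : {poly int}) :
  poly_series (a * (x * x) * (y * y) * p2 + (b * x + c) * x * y * p1
               + (d * (x * x) + e * x + 1) * p0) =
  poly_series a * (poly_series x * poly_series x) * (poly_series y * poly_series y)
    * poly_series p2
  + (poly_series b * poly_series x + poly_series c) * poly_series x * poly_series y
    * poly_series p1
  + (poly_series d * (poly_series x * poly_series x) + poly_series e * poly_series x + 1)
    * poly_series p0.
  by rewrite !(psD, psM) (rmorph1 poly_series).
by rewrite /face_op derivSn derivn1 !expr2 gen !psn.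
Qed.

(** Each derivative that falls on the power of 1 - 4z lowers its exponent by one; all
terms are brought to the lowest exponent -(3g+9/2), that of q. *)
Lemma face_op_pow_series g (p : {poly int}) (c q : series) :
  q = pow_series (- ((3 * g)%:R + 9 / 2)) ->
  c = poly_series p * (one_sub_4z * (one_sub_4z * q)) ->
  2 * (zvar * (zvar * sderiv (sderiv c))) + 5 * (zvar * sderiv c) + c
  + 2 * (zvar * (poly_series p * q))
  = poly_series (face_op g p) * q.
Proof.
move=> hq ->.
have e1 : one_sub_4z * q = pow_series (1 - ((3 * g)%:R + 9 / 2)).
  by rewrite hq -pow_series1 pow_seriesD.
have e2 : one_sub_4z * (one_sub_4z * q) = pow_series (2 - ((3 * g)%:R + 9 / 2)).
  by rewrite e1 -pow_series1 pow_seriesD; congr pow_series; ring.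
have d2 : sderiv (one_sub_4z * (one_sub_4z * q)) = (one_sub_4z * q) *+ (12 * g + 10).
  rewrite e2 sderiv_pow_series e1 -[RHS]mulr_natl -(rmorph_nat series_cst).
  by congr (series_cst _ * pow_series _); rewrite ?natrD ?natrM; field.
have d1 : sderiv (one_sub_4z * q) = q *+ (12 * g + 14).
  rewrite e1 sderiv_pow_series hq -[RHS]mulr_natl -(rmorph_nat series_cst).
  by congr (series_cst _ * pow_series _); rewrite ?natrD ?natrM; field.
move: d1 d2 {e1 e2}; have [Q1 E1] : exists Q1, Q1 = one_sub_4z * q by exists (one_sub_4z * q).
rewrite -E1; have [Q2 E2] : exists Q2, Q2 = one_sub_4z * Q1 by exists (one_sub_4z * Q1).
rewrite -E2 => d1 d2.
rewrite sderivM sderiv_poly d2 sderivD !sderivM !sderiv_poly d2 sderivMn d1.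
by rewrite poly_series_face_op E2 E1 one_sub_4zE; ring.
Qed.

Lemma big_ord_ends (V : nmodType) (F : nat -> V) g :
  \sum_(h < g.+2) F h = F 0 + \sum_(1 <= h < g.+1) F h + F g.+1.
Proof. by rewrite -(big_mkord xpredT F) big_nat_recr //= big_ltn. Qed.

Theorem theorem3 (P P2 : nat -> {poly int})
  (hP : forall g : nat, (1 <= g)%N ->
     C 1 g =1 poly_div_pow (P g) ((3 * g)%:R - 1 / 2))
  (hP_size : forall g : nat, (1 <= g)%N -> (size (P g) <= (3 * g - 1).+1)%N)
  (hP_dvd : forall g : nat, (1 <= g)%N ->
     exists q : {poly int}, P g = 'X^(2 * g) * q)
  (hP2 : forall g : nat,
     C 2 g =1 poly_div_pow (P2 g) ((3 * g)%:R + 2))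
  (hP2_size : forall g : nat, (size (P2 g) <= (3 * g + 1).+1)%N)
  (hP2_dvd : forall g : nat,
     exists q : {poly int}, P2 g = 'X^(2 * g + 1) * q)
  (g : nat) :
  exists P3 : {poly int},
    [/\ C 3 g =1 poly_div_pow P3 ((3 * g)%:R + 9 / 2),
        P3 = drop_poly 1 (P2 g.+1)
             - 2 * (\sum_(1 <= h < g.+1) P h * P2 (g.+1 - h)%N)
             - 2 * 'X^2 * (1 - 4 * 'X) ^+ 2 * (P g.+1)^`(2)
             - ((48 * g + 20)%:R * 'X + 5) * 'X * (1 - 4 * 'X) * (P g.+1)^`()
             - ((48 * (2 * g + 1) * (3 * g + 2))%:R * 'X^2
                + (60 * g + 44)%:R * 'X + 1) * P g.+1,
        (size P3 <= (3 * g + 3).+1)%N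
      & exists q : {poly int}, P3 = 'X^(2 * g + 2) * q].
Proof.
have hC1 h : (1 <= h)%N -> C_series 1 h = poly_series (P h) * pow_series (1 / 2 - (3 * h)%:R).
  move=> hh; apply/funext => n; rewrite /C_series (hP _ hh) /poly_div_pow seriesM.
  by congr (fps_mul _ (pow_1m4z _) _); ring.
have hC2 h : C_series 2 h = poly_series (P2 h) * pow_series (- ((3 * h)%:R + 2)).
  by apply/funext => n; rewrite /C_series hP2.
(* Divisibility by z and the degree leave one coefficient, the number of gluings of
   two 1-gons. *)
have hP20 : P2 0 = 'X.
  have [q eq] := hP2_dvd 0%N; have h1 : (P2 0)`_0 = 0 by rewrite eq coefXnM.
  have h2 : (P2 0)`_1 = 1.
    have := congr1 (fun s : series => s 1%N) (hC2 0%N).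
    rewrite /= /C_series /C eps2_g0_n1 seriesM /fps_mul !big_ord_recl big_ord0 addr0 /=.
    rewrite /poly_series /fps_poly h1 mul0r add0r /bump /= pow_series_coef0 mulr1.
    by move=> e; apply: (@intr_inj rat); rewrite -e.
  apply/polyP => -[|[|i]]; rewrite ?coefX ?h1 ?h2 //=.
  by apply: (leq_sizeP _ _ (hP2_size 0%N)).
have g1 : (1 <= g.+1)%N by [].
have P_size := hP_size _ g1; have P_dvd := hP_dvd _ g1.
set S := \sum_(1 <= h < g.+1) _.
exists (drop_poly 1 (P2 g.+1) - 2 * S - face_op g (P g.+1)); split.
- move=> n; rewrite -[LHS]/(C_series 3 g n); congr (_ n); apply: zvar_inj.
  transitivity (zvar * (poly_series (drop_poly 1 (P2 g.+1) - 2 * S - face_op g (P g.+1))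
    * pow_series (- ((3 * g)%:R + 9 / 2)))); last by [].
  set q := pow_series _; set D := drop_poly 1 _.
  have natS : (3 * g.+1)%:R = (3 * g)%:R + 3 :> rat by rewrite mulnS natrD addrC.
  have e1 : C_series 1 g.+1 = poly_series (P g.+1) * (one_sub_4z * (one_sub_4z * q)).
    rewrite hC1 // -pow_series1 !pow_seriesD; congr (_ * pow_series _).
    by rewrite natS; field.
  (* The factor 1 - 2 z C_0 of C_(g+1)^[2] supplies the missing half power. *)
  have e2 : C_series 2 g.+1 * pow_series (1 / 2) = zvar * (poly_series D * q).
    rewrite hC2 -mulrA pow_seriesD.
    have -> : P2 g.+1 = 'X * D.
      have [r er] := hP2_dvd g.+1; rewrite mulrC -[LHS](poly_take_drop 1) -/D expr1.
      rewrite (_ : take_poly 1 _ = 0) ?add0r //; apply/polyP => i.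
      rewrite coef_take_poly coef0; case: ltnP => // hi.
      by rewrite er coefXnM (_ : (i < _)%N) //; lia.
    rewrite (rmorphM poly_series) -/zvar -mulrA; congr (_ * (_ * pow_series _)).
    by rewrite natS; field.
  have e3 : \sum_(1 <= h < g.+1) C_series 1 h * C_series 2 (g.+1 - h) = poly_series S * q.
    rewrite /S (rmorph_sum poly_series) mulr_suml; apply: eq_big_nat => h /andP[h0 hg].
    rewrite hC1 // hC2 (rmorphM poly_series) mulrACA pow_seriesD; congr (_ * pow_series _).
    have -> : (3 * g)%:R = (3 * h)%:R + (3 * (g.+1 - h))%:R - 3 :> rat.
      by rewrite -natrD -mulnDr (subnKC (ltnW hg)) natS addrK.
    by field.
  (* The term h = g + 1, which becomes a part of the operator on P_(g+1). *)
  have e4 : C_series 1 g.+1 * C_series 2 0 = zvar * (poly_series (P g.+1) * q).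
    rewrite hC1 // hC2 hP20 muln0 add0r -/zvar mulrACA pow_seriesD [_ * zvar]mulrC -mulrA.
    by congr (_ * (_ * pow_series _)); rewrite natS; field.
  have := C_series_rec g.
  rewrite (@big_ord_ends _ (fun h => C_series 1 h * C_series 2 (g.+1 - h))).
  rewrite subn0 subnn e3 e4 => rec.
  have e5 := face_op_pow_series (erefl q) e1.
  have psB a b : poly_series (a - b) = poly_series a - poly_series b by exact: rmorphB.
  have psS : poly_series (2 * S) = 2 * poly_series S.
    by rewrite (rmorphM poly_series) (rmorph_nat poly_series).
  rewrite !psB psS.
  move: rec e2 e5; rewrite -C_series_sqrt.
  set c1 := C_series 1 g.+1; set c2 := C_series 2 g.+1.
  set c3 := C_series 3 g; set c0 := C_series 1 0.
  set dc := sderiv c1; set ddc := sderiv dc; set pP := poly_series (P g.+1).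
  set pS := poly_series S; set pE := poly_series (face_op g _); set pD := poly_series D.
  move=> rec e2 e5.
  transitivity (c2 * (1 - 2 * (zvar * c0)) - zvar * (2 * (pS * q))
     - zvar * (2 * (zvar * (zvar * ddc)) + 5 * (zvar * dc) + c1 + 2 * (zvar * (pP * q)))).
    have -> : c2 * (1 - 2 * (zvar * c0)) = c2 - 2 * (zvar * (c0 * c2)) by ring.
    by rewrite {1}rec; ring.
  by rewrite e2 e5; ring.
- by rewrite /face_op; ring.
- apply/leq_sizeP => i hi.
  rewrite !coefB coef_drop_poly (leq_sizeP _ _ (hP2_size g.+1)); last by lia.
  rewrite mulr_natl coefMn coef_sum big1_seq => [|h]; last first.
    rewrite mem_index_iota => /andP[_ /andP[h0 hg]].
    apply: (leq_sizeP _ _ (leqnn _)); apply: leq_trans hi.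
    apply: leq_trans (size_polyMleq _ _) _.
    have := hP_size h h0; have := hP2_size (g.+1 - h)%N.
    by move: (size _) (size _); lia.
  have hPi j : (3 * g + 3 <= j)%N -> (P g.+1)`_j = 0.
    by move=> hj; apply: (leq_sizeP _ _ P_size); lia.
  have [T0 [T1 ->]] := coef_face_op g (P g.+1).
  case: i hi => [|[|j]] hi; [lia|lia|].
  rewrite hPi ?(hPi j.+1); [|lia|lia].
  rewrite mul0rn subr0 !mulr0 !add0r.
  (* Beyond the degree bound only the part of degree 2 of the operator contributes,
     applied to the leading monomial z^(3g+2), which it kills. *)
  have [->|ne] := eqVneq j (3 * g + 2)%N; first by rewrite subrr mulr0 !mul0r oppr0.
  by rewrite hPi ?mulr0 ?oppr0 //; lia.
apply/Xn_dvdP => i hi; rewrite !coefB.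
have hPi j : (j < 2 * g + 2)%N -> (P g.+1)`_j = 0.
  by move=> hj; apply: (proj1 (Xn_dvdP _ (2 * g.+1)) P_dvd); lia.
have [T0 [T1 ->]] := coef_face_op g (P g.+1).
rewrite coef_drop_poly (proj1 (Xn_dvdP _ _) (hP2_dvd g.+1)); last by lia.
rewrite mulr_natl coefMn coef_sum big1_seq => [|h]; last first.
  rewrite mem_index_iota => /andP[_ /andP[h0 hg]].
  have [q1 ->] := hP_dvd h h0; have [q2 ->] := hP2_dvd (g.+1 - h)%N.
  rewrite mulrACA -exprD coefXnM (_ : (i < _)%N) //; lia.
rewrite hPi // mul0rn subr0 mulr0 !add0r.
case: i hi => [|[|j]] hi; rewrite ?hPi ?mulr0 ?addr0 ?oppr0 //; lia.
Qed.
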